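(* There exist translation surfaces of finite area whose Veech group is a cyclic hyperbolic subgroup of $\mathrm{SL}_2(\mathbb{R})$, that is, an infinite cyclic group all of whose non-trivial elements are hyperbolic.
   Context: A translation surface is a connected orientable 2-dimensional manifold $X$ together with a (possibly empty) discrete set of points $\Sigma\subset X$, called singularities, and an atlas on the regular part $X\setminus\Sigma$ all of whose transition maps are restrictions of translations of $\mathbb{R}^2$. The surface is not required to be compact, nor is the flat metric required to be complete. The regular part carries a canonical flat Riemannian metric, obtained by pulling back the Euclidean metric of $\mathbb{R}^2$ via the charts; the area of $X$ is the area of this metric. An affine homeomorphism of $X$ is an orientation-preserving homeomorphism $f:X\to X$ (preserving the set of singularities) which, in the charts of the translation atlas, is the restriction of an affine self-map of $\mathbb{R}^2$. It has a well-defined linear part $Df\in\mathrm{GL}_2^+(\mathbb{R})$ (the same in all charts). Let $\mathrm{Aff}(X)$ be the group of affine homeomorphisms of $X$. The Veech group of $X$ is the image of the homomorphism $\mathrm{Aff}(X)\to\mathrm{GL}_2^+(\mathbb{R})$, $f\mapsto Df$. If $X$ has finite area, the Veech group is contained in $\mathrm{SL}_2(\mathbb{R})$. An element $A\in\mathrm{SL}_2(\mathbb{R})$ is hyperbolic if $|\mathrm{tr}(A)|>2$. *)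

(* Defs.v *)
From HB Require Import structures.
From mathcomp Require Import all_boot all_order all_algebra.
From mathcomp Require Import all_classical all_reals all_analysis.

Set Implicit Arguments.
Unset Strict Implicit.
Unset Printing Implicit Defensive.

Import Order.TTheory GRing.Theory Num.Theory.
Import numFieldNormedType.Exports.

Local Open Scope classical_set_scope.
Local Open Scope ring_scope.

(* The Euclidean plane is R * R; its points are column vectors for the action of
   matrices, so that D (f \o g) = Df *m Dg. *)

Definition plane_area (R : realType) : set (R * R) -> \bar R :=
  (lebesgue_measure \x lebesgue_measure)%E.

Definition linear_action (R : realType) (A : 'M[R]_2) (p : R * R) : R * R :=
  (A 0 0 * p.1 + A 0 1 * p.2, A 1 0 * p.1 + A 1 1 * p.2).

Definition polar (R : realType) (p : R * R) (r t : R) : R * R :=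
  (p.1 + r * cos t, p.2 + r * sin t).

(* A homeomorphism from an open subset of X onto an open subset of the plane;
   the values of the coordinate map outside the domain are irrelevant. *)
Record chart (R : realType) (X : topologicalType) := Chart {
  chart_dom : set X;
  chart_map :> X -> R * R;
  chart_dom_open : open chart_dom;
  chart_continuous : {within chart_dom, continuous chart_map};
  chart_inj : {in chart_dom &, injective chart_map};
  chart_open_map : forall V : set X,
    V `<=` chart_dom -> open V -> open (chart_map @` V)
}.

Definition charts_cover (R : realType) (X : topologicalType)
    (Y : set X) (T : set (chart R X)) : Prop :=
  \bigcup_(c in T) chart_dom c = Y.

Definition topological_surface (R : realType) (X : topologicalType) : Prop :=
  [/\ hausdorff_space X, @second_countable X &
      charts_cover [set: X] [set: chart R X]].

(* Meaningful on c @` (chart_dom c `&` chart_dom d). *)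
Definition transition (R : realType) (X : ptopologicalType) (c d : chart R X)
    (p : R * R) : R * R :=
  d ('pinv_(fun=> point) (chart_dom c) c p).

(* The image under h of every small positively oriented circle around p has
   winding number 1 around h p (theta is a continuous choice of the argument of
   h - h p along the circle). For a homeomorphism h between open subsets of the
   plane the winding number is 1 or -1, and this says that h has local
   degree 1 at p; no differentiability of h is needed. *)
Definition preserves_orientation_at (R : realType) (h : R * R -> R * R)
    (p : R * R) : Prop :=
  exists2 e : R, 0 < e & forall r : R, 0 < r < e ->
    exists theta : R -> R,
      [/\ continuous theta,
          theta (2 * pi) = theta 0 + 2 * pi &
          forall t : R, 0 <= t <= 2 * pi ->
            exists2 rho : R, 0 < rho &
              h (polar p r t) = polar (h p) rho (theta t)].

Definition orientable (R : realType) (X : ptopologicalType) : Prop :=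
  exists2 T : set (chart R X), charts_cover [set: X] T &
    forall c d : chart R X, T c -> T d ->
      forall x : X, chart_dom c x -> chart_dom d x ->
        preserves_orientation_at (transition c d) (c x).

(* Each transition map is the restriction of one translation. This is no
   restriction on the surface: an atlas whose transition maps are only locally
   translations can be refined by shrinking its charts, with the same area and
   the same affine homeomorphisms.

   The carrier is pointed, hence nonempty, because the library's Borel
   sigma-algebras live on pointed types. Chart domains are open in the
   surface, so sing_discrete and atlas_cover make the set of singularities
   closed and discrete. *)
Record translation_surface (R : realType) := TranslationSurface {
  carrier :> ptopologicalType;
  sing : set carrier;
  atlas : set (chart R carrier);
  surface_connected : connected [set: carrier];
  surface_manifold : topological_surface R carrier;
  surface_orientable : orientable R carrier;
  sing_discrete : isolated sing = sing;
  atlas_cover : charts_cover (~` sing) atlas;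
  atlas_translation : forall c d : chart R carrier, atlas c -> atlas d ->
    exists v : R * R, forall x : carrier,
      chart_dom c x -> chart_dom d x -> d x = c x + v
}.

(* The Riemannian area of the flat metric pulled back by the charts: the unique
   Borel measure that is planar area in every chart, with the (countable) set
   of singularities a null set. *)
Definition is_area_measure (R : realType) (S : translation_surface R)
    (mu : {measure set (g_sigma_algebraType (@open S)) -> \bar R}) : Prop :=
  mu (@sing R S) = 0%E /\
  forall c : chart R S, atlas c ->
    forall B : set S, (@open S).-sigma.-measurable B -> B `<=` chart_dom c ->
      mu B = plane_area (c @` B).

Definition finite_area (R : realType) (S : translation_surface R) : Prop :=
  exists mu : {measure set (g_sigma_algebraType (@open S)) -> \bar R},
    is_area_measure mu /\ (mu [set: S] < +oo)%E.

Definition homeomorphism (X : topologicalType) (f : X -> X) : Prop :=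
  continuous f /\
  exists g : X -> X, [/\ continuous g, cancel f g & cancel g f].

(* The vector b depends on x: the set of points where the expression of f in
   two given charts is defined may be disconnected. *)
Definition affine_at (R : realType) (S : translation_surface R) (f : S -> S)
    (A : 'M[R]_2) (x : S) : Prop :=
  forall c d : chart R S, atlas c -> atlas d ->
    chart_dom c x -> chart_dom d (f x) ->
    exists b : R * R, \forall y \near x, d (f y) = linear_action A (c y) + b.

(* All transition maps preserve orientation, so an affine f preserves
   orientation exactly when its linear part has positive determinant. *)
Definition affine_homeomorphism (R : realType) (S : translation_surface R)
    (f : S -> S) : Prop :=
  [/\ homeomorphism f,
      f @` @sing R S = @sing R S &
      forall x : S, ~ sing x -> exists A : 'M[R]_2, 0 < \det A /\ affine_at f A x].

Definition linear_part (R : realType) (S : translation_surface R) (f : S -> S)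
    (A : 'M[R]_2) : Prop :=
  forall x : S, ~ sing x -> affine_at f A x.

Definition veech_group (R : realType) (S : translation_surface R) :
    set 'M[R]_2 :=
  [set A | exists2 f : S -> S, affine_homeomorphism f & linear_part f A].

Definition SL2 (R : realType) : set 'M[R]_2 := [set A | \det A = 1].

Definition hyperbolic (R : realType) (A : 'M[R]_2) : Prop :=
  SL2 A /\ 2 < `|\tr A|.

Definition infinite_cyclic (R : realType) (G : set 'M[R]_2) : Prop :=
  infinite_set G /\
  exists2 A : 'M[R]_2, A \in unitmx & G = [set A ^ k | k in [set: int]].

(* Main.v *)
From HB Require Import structures.
Require Import Defs.
From mathcomp Require Import all_boot all_order all_algebra.
From mathcomp Require Import all_classical all_reals all_analysis.
From mathcomp Require Import measurable_realfun ring lra zify.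

Set Implicit Arguments.
Unset Strict Implicit.
Unset Printing Implicit Defensive.

Import Order.TTheory GRing.Theory Num.Theory.
Import numFieldNormedType.Exports.

Local Open Scope classical_set_scope.
Local Open Scope ring_scope.

(** Let mu = 3 + 2 sqrt 2 and let L be the image of Z[sqrt 2] in the plane under
    its two real embeddings. Since mu is a unit of norm 1, the matrix
    diag(mu, 1/mu) preserves L and induces a hyperbolic automorphism of the
    torus R^2/L. The image of (1, 0) is homoclinic to the origin: (mu^n, 0) and
    (0, -mu^-n) differ by (mu^n, mu^-n), a point of L, so its orbit tends to the
    origin in both directions of time. The surface is the torus punctured at
    the origin, with the points of this orbit as singularities; they accumulate
    only at the puncture, hence form a closed discrete set. The area is that of
    a fundamental parallelogram ([marked_torus_finite_area]), and the powers of
    the automorphism put the powers of diag(mu, 1/mu) into the Veech group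
    ([squeeze_veech]).

    Conversely, let f be an affine homeomorphism with linear part B. The plane
    minus a countable set is connected, so f is given there by p |-> B p + b
    modulo L with one constant b, and by continuity this remains true at the
    marked points ([affine_lift]). Translating p by L gives B L <= L. The
    vector b lies in L: otherwise f would send points tending to the puncture to
    points tending to the class of b, which f^-1 sends to a point of the surface
    ([affine_lift_origin]). Hence B maps the lifted orbit into itself.

    The arithmetic input is that a nonzero (x, y) in L has |x y| >= 1, being the
    norm of a nonzero algebraic integer ([lattice_small]). It implies that near
    0 the lifted orbit consists of points on two rays, the positive x-axis and
    the negative y-axis ([homoclinic_near0]). So B maps each ray to a ray, with
    a power of mu as ratio; orientation forbids exchanging the rays, and
    B(1, 1) in L forces the two exponents to be opposite
    ([lattice_homoclinic_preserved]). Thus B is a power of diag(mu, 1/mu). *)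

(** * The lattice of Z[sqrt 2] and its units *)
Section Lattice.
Context {R : realType}.
Implicit Types (p q l z : R * R).

Definition sqrt2 : R := Num.sqrt 2.

Definition lat (a b : int) : R * R :=
  (a%:~R + b%:~R * sqrt2, a%:~R - b%:~R * sqrt2).

Definition lattice : set (R * R) := [set l | exists a b, l = lat a b].

Lemma sqr_sqrt2 : sqrt2 * sqrt2 = 2.
Proof. by rewrite -expr2 sqr_sqrtr. Qed.

Lemma sqrt2_gt1 : 1 < sqrt2.
Proof.
have := sqr_sqrt2; have : 0 <= sqrt2 by exact: sqrtr_ge0.
by move=> ? ?; nra.
Qed.

Lemma sqrt2_lt2 : sqrt2 < 2.
Proof. by have := sqr_sqrt2; have := sqrt2_gt1; nra. Qed.

Lemma pairB (a b c d : R) : (a, b) - (c, d) = (a - c, b - d) :> R * R.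
Proof. by []. Qed.

Lemma lattice0 : lattice 0.
Proof. by exists 0, 0; rewrite /lat !mul0r addr0 subr0. Qed.

Lemma latticeB l l' : lattice l -> lattice l' -> lattice (l - l').
Proof.
move=> [a [b ->]] [c [d ->]]; exists (a - c), (b - d).
by rewrite /lat pairB; congr pair; rewrite !intrB; ring.
Qed.

Lemma latticeN l : lattice l -> lattice (- l).
Proof. by move=> Ll; rewrite -sub0r; apply: latticeB => //; exact: lattice0. Qed.

Lemma latticeD l l' : lattice l -> lattice l' -> lattice (l + l').
Proof. by move=> Ll Ll'; rewrite -[l']opprK; apply/latticeB/latticeN. Qed.

(** The product of Z[sqrt 2], computed in the two embeddings. *)
Lemma latticeM l l' : lattice l -> lattice l' -> lattice (l.1 * l'.1, l.2 * l'.2).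
Proof.
move=> [a [b ->]] [c [d ->]]; exists (a * c + 2 * b * d), (a * d + b * c).
have ss := sqr_sqrt2.
by rewrite /lat /=; congr pair; rewrite !intrD !intrM; ring: ss.
Qed.

(** Irrationality of sqrt 2: the exponents of 2 in the two sides have different
    parities. *)
Lemma nat_sqr_double (a b : nat) : (a ^ 2 = 2 * b ^ 2 -> b = 0)%N.
Proof.
move=> e; apply/eqP; rewrite -leqn0 leqNgt; apply/negP => b0.
have a0 : (0 < a)%N by move: e; case: a => //; nia.
have := congr1 (odd \o logn 2) e.
by rewrite /= lognM ?expn_gt0 ?b0// !lognX (logn_prime 2 (isT : prime 2))/= !oddM.
Qed.

(** The product of the coordinates is the norm a^2 - 2 b^2, an
    integer, which vanishes only for a = b = 0. *)
Lemma lattice_small l : lattice l -> `|l.1 * l.2| < 1 -> l = 0.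
Proof.
move=> [a [b ->]] /=.
have -> : (a%:~R + b%:~R * sqrt2) * (a%:~R - b%:~R * sqrt2) =
    (a * a - 2 * (b * b))%:~R.
  by rewrite intrB !intrM; ring: sqr_sqrt2.
rewrite -intr_norm -[1]/(1%:~R) ltr_int => ab.
have {}ab : a * a = 2 * (b * b) by lia.
have b0 : `|b|%N = 0%N.
  by apply: (@nat_sqr_double `|a|%N); lia.
have {}b0 : b = 0 by lia.
by move: ab => /eqP; rewrite b0 !mulr0 mulf_eq0 orbb => /eqP ->; rewrite /lat !mul0r addr0 subr0.
Qed.

Lemma countable_lattice : countable lattice.
Proof.
rewrite (_ : lattice = (fun ab : int * int => lat ab.1 ab.2) @` setT).
  exact: (sub_countable (card_image_le _ _)).
by apply/seteqP; split => [l [a [b ->]]|l [[a b] _ <-]]; [exists (a, b)|exists a, b].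
Qed.

Definition mu : R := 3 + 2 * sqrt2.

Lemma mu_gt1 : 1 < mu.
Proof. by have := sqrt2_gt1; rewrite /mu; lra. Qed.

Lemma mu_gt0 : 0 < mu. Proof. exact: lt_trans mu_gt1. Qed.

Lemma muV : mu^-1 = 3 - 2 * sqrt2.
Proof.
apply: (mulfI (lt0r_neq0 mu_gt0)); rewrite mulfV ?lt0r_neq0 ?mu_gt0//.
by rewrite /mu; ring: sqr_sqrt2.
Qed.

Lemma mu_expz_gt0 (n : int) : 0 < mu ^ n.
Proof. by rewrite exprz_gt0 ?mu_gt0. Qed.

(** 3 - 2 sqrt 2 is both the conjugate and the inverse of mu. *)
Lemma lattice_unit (n : int) : lattice (mu ^ n, mu ^ (- n)).
Proof.
have H m : lattice (mu ^+ m, mu ^- m) /\ lattice (mu ^- m, mu ^+ m).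
  elim: m => [|m [IH1 IH2]]; first by rewrite invr1; split; exists 1, 0;
    rewrite /lat !mul0r addr0 subr0.
  rewrite !exprS !invfM; split.
    apply: (@latticeM (mu, mu^-1) _ _ IH1); exists 3, 2; rewrite muV /lat.
    by congr pair.
  apply: (@latticeM (mu^-1, mu) _ _ IH2); exists 3, (-2); rewrite muV /lat.
  by congr pair; rewrite /mu; ring.
by case: n => m; rewrite ?NegzE ?opprK -?exprnN -?exprnP; case: (H m); case: (H m.+1).
Qed.

End Lattice.

(** * The lifted homoclinic orbit *)
Section Orbit.
Context {R : realType}.
Implicit Types (p q l z : R * R).
Notation lattice := (@lattice R).
Notation mu := (@mu R).

Lemma cvg_pairR {T} {F : set_system T} {FF : Filter F} (f : T -> R * R) p :
  ((f x).1 : R) @[x --> F] --> (p.1 : R) ->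
  ((f x).2 : R) @[x --> F] --> (p.2 : R) -> f @ F --> p.
Proof.
move=> /cvg_ballP f1 /cvg_ballP f2; apply/cvg_ballP => e e0.
by near=> x; split; near: x; [exact: f1|exact: f2].
Unshelve. all: by end_near. Qed.

Lemma finite_gap (w : nat -> R * R) z (N : nat) :
  exists2 e : R, 0 < e & forall n, (n < N)%N -> ball z e (w n) -> w n = z.
Proof.
elim: N => [|N [e e0 IH]]; first by exists 1.
have [wz|/eqP wz] := eqVneq (w N) z.
  exists e => // n; rewrite ltnS leq_eqVlt => /predU1P[->//|]; exact: IH.
have h : 0 < `|z - w N| by rewrite normr_gt0 subr_eq0; apply/eqP => /esym.
exists (Num.min e `|z - w N|); first by rewrite lt_min e0.
move=> n; rewrite ltnS leq_eqVlt => /predU1P[->|nN].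
  rewrite -ball_normE/= => hh; have : `|z - w N| < `|z - w N|.
    by apply: lt_le_trans hh _; rewrite ge_min lexx orbT.
  by rewrite ltxx.
move=> hb; apply: IH => //; apply: le_ball hb.
by rewrite ge_min lexx.
Qed.

(** If two lattice vectors bring terms of the sequence within 1/4 of z, the
    coordinates of their difference are less than a + 1/2 and b + 1/2, so its
    norm is less than 1 and they coincide. Thus near z only one translate of the
    sequence is visible, and it accumulates only at a lattice point. *)
Lemma lattice_translates_isolated (v : nat -> R * R) (a b : R) z :
    (forall n m, `|(v n).1 - (v m).1| <= a /\ `|(v n).2 - (v m).2| <= b) ->
    (a + 2^-1) * (b + 2^-1) < 1 -> v @ \oo --> (0 : R * R) -> ~ lattice z ->
  exists2 e : R, 0 < e &
    forall n l, lattice l -> ball z e (v n + l) -> v n + l = z.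
Proof.
move=> vab ab1 v0 Lz.
have [[n0 [l0 [Ll0 zl0]]]|none] :=
  pselect (exists n0 l0, lattice l0 /\ ball z 4^-1 (v n0 + l0)); last first.
  exists 4^-1 => // n l Ll zl; exfalso; apply: none; exists n, l; split => //.
have uniq_l n l : lattice l -> ball z 4^-1 (v n + l) -> l = l0.
  move=> Ll zl; apply/eqP; rewrite -subr_eq0; apply/eqP.
  apply: lattice_small; first exact: latticeB.
  have [va vb] := vab n0 n.
  move: zl zl0 => [/= z1 z2] [/= z3 z4].
  rewrite normrM; apply: le_lt_trans ab1; apply: ler_pM => //.
    by move: va z1 z3; rewrite /ball/= !(ltr_norml, ler_norml) => /andP[? ?] /andP[? ?] /andP[? ?]; apply/andP; split; lra.
  by move: vb z2 z4; rewrite /ball/= !(ltr_norml, ler_norml) => /andP[? ?] /andP[? ?] /andP[? ?]; apply/andP; split; lra.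
have zl00 : 0 < `|z - l0|.
  by rewrite normr_gt0 subr_eq0; apply: contra_notN Lz => /eqP ->.
have /cvgrPdist_lt/(_ (`|z - l0| / 2)) := v0.
move=> /(_ (divr_gt0 zl00 (ltr0n _ 2)))[N _ HN].
have [e e0 He] := finite_gap (fun n => v n + l0) z N.
exists (Num.min e (Num.min 4^-1 (`|z - l0| / 2))).
  by rewrite !lt_min e0 invr_gt0 ltr0n (divr_gt0 zl00).
move=> n l Ll zl.
have ll0 : l = l0.
  by apply: (uniq_l n) => //; apply: le_ball zl; rewrite !ge_min lexx orbT.
move: zl; rewrite {}ll0 => zl.
have [nN|Nn] := ltnP n N.
  by apply: He => //; apply: le_ball zl; rewrite ge_min lexx.
have := HN n Nn; rewrite /= sub0r normrN => vn.
have {}zl : ball z (`|z - l0| / 2) (v n + l0).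
  by apply: le_ball zl; rewrite !ge_min lexx !orbT.
move: zl; rewrite -ball_normE/= => zl.
have : `|z - l0| < `|z - l0|.
  rewrite [ltRHS]splitr; apply: le_lt_trans (ltrD zl vn).
  by apply: le_trans (ler_normD _ _); rewrite opprD addrA addrAC subrK.
by rewrite ltxx.
Qed.

(** The preimage in the plane of the orbit of the homoclinic point. *)
Definition homoclinic : set (R * R) :=
  [set p | exists n : int, lattice (p - (mu ^ n, 0))].

Lemma cvg_muVn : (fun n : nat => mu ^- n) @ \oo --> (0 : R).
Proof.
under eq_fun do rewrite -exprVn.
by apply: cvg_expr; rewrite ger0_norm ?invr_ge0 ?ltW ?mu_gt0// invf_lt1 ?mu_gt0// mu_gt1.
Qed.

Lemma muVn_bounds n : 0 < mu ^- n <= 1.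
Proof.
by rewrite invr_gt0 exprn_gt0 ?mu_gt0//= invf_le1 ?exprn_gt0 ?mu_gt0// exprn_ege1// ltW// mu_gt1.
Qed.

(** Along each half of the orbit the representative that tends to 0 is used: the
    one on the x-axis in the past, the one on the y-axis in the future. *)
Lemma homoclinic_splits p : homoclinic p <->
  exists n : nat, lattice (p - (mu ^- n, 0)) \/ lattice (p - (0, - mu ^- n)).
Proof.
have E (n : int) : lattice ((mu ^ n, 0) - (0, - mu ^ (- n))).
  by rewrite pairB subr0 sub0r opprK; exact: lattice_unit.
split=> [[[n|n] pn]|[n [pn|pn]]].
- exists n; right.
  by have := latticeD pn (E n); rewrite addrA subrK -exprnN.
- by exists n.+1; left; move: pn; rewrite NegzE -exprnN.
- by exists (- n%:Z); rewrite -exprnN.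
- exists n%:Z; have := latticeB pn (E n).
  by rewrite -exprnN opprB addrA subrK.
Qed.

(** This gives both that the orbit is discrete and that, together with the
    lattice, it is closed. *)
Lemma homoclinic_isolated z : ~ lattice z ->
  exists2 e : R, 0 < e & forall p, homoclinic p -> ball z e p -> p = z.
Proof.
move=> Lz.
have [e1 e10 H1] : exists2 e : R, 0 < e &
    forall n l, lattice l -> ball z e ((mu ^- n, 0) + l) -> (mu ^- n, 0) + l = z.
  apply: (@lattice_translates_isolated _ 1 0) => //=; last 2 first.
  - lra.
  - by apply: cvg_pairR => //=; [exact: cvg_muVn|exact: cvg_cst].
  - move=> n m; rewrite subrr normr0; split => //.
    by have := muVn_bounds n; have := muVn_bounds m; rewrite ler_norml => /andP[? ?] /andP[? ?]; apply/andP; split; lra.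
have [e2 e20 H2] : exists2 e : R, 0 < e &
    forall n l, lattice l -> ball z e ((0, - mu ^- n) + l) -> (0, - mu ^- n) + l = z.
  apply: (@lattice_translates_isolated _ 0 1) => //=; last 2 first.
  - lra.
  - apply: cvg_pairR => //=; first exact: cvg_cst.
    by rewrite -oppr0; apply: cvgN; exact: cvg_muVn.
  - move=> n m; rewrite subrr normr0; split => //.
    by have := muVn_bounds n; have := muVn_bounds m; rewrite ler_norml => /andP[? ?] /andP[? ?]; apply/andP; split; lra.
exists (Num.min e1 e2); first by rewrite lt_min e10.
move=> p /homoclinic_splits[n [pn|pn]] zp.
  rewrite -[p](subrK (mu ^- n, 0)) addrC; apply: H1 => //; rewrite addrC subrK.
  by apply: le_ball zp; rewrite ge_min lexx.
rewrite -[p](subrK (0, - mu ^- n)) addrC; apply: H2 => //; rewrite addrC subrK.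
by apply: le_ball zp; rewrite ge_min lexx orbT.
Qed.

Lemma lattice_isolated z : ~ lattice z ->
  exists2 e : R, 0 < e & forall l, lattice l -> ~ ball z e l.
Proof.
move=> Lz.
have [||e e0 H] := @lattice_translates_isolated (cst 0) 0 0 z _ _ (cvg_cst _) Lz.
- by move=> n m; rewrite !subrr normr0.
- lra.
- exists e => // l Ll zl; apply: Lz; have := H 0%N l Ll.
  by rewrite add0r => <-.
Qed.

(** The lattice vector relating p to its representative on an axis has norm less
    than (1/4) (5/4) < 1, hence vanishes. *)
Lemma homoclinic_near0 p : homoclinic p -> ball (0 : R * R) 4^-1 p ->
  exists n : int, p = (mu ^ n, 0) \/ p = (0, - mu ^ n).
Proof.
move=> /homoclinic_splits[n pn] [/= p1 p2]; exists (- n%:Z); rewrite -exprnN.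
move: p1 p2; rewrite /ball/= !sub0r !normrN => p1 p2.
have /andP[mun0 mun1] := muVn_bounds n.
case: pn => pn; [left|right]; apply/eqP; rewrite -subr_eq0; apply/eqP; apply: lattice_small => //=.
  rewrite subr0 normrM.
  have h1 : `|p.1 - mu ^- n| <= 3 / 2 by move: p1; rewrite ltr_norml ler_norml => /andP[? ?]; apply/andP; split; lra.
  by move: p2 h1 (normr_ge0 p.2) (normr_ge0 (p.1 - mu ^- n)); nra.
rewrite subr0 normrM.
have h1 : `|p.2 - - mu ^- n| <= 3 / 2 by move: p2; rewrite ltr_norml ler_norml => /andP[? ?]; apply/andP; split; lra.
by move: p1 h1 (normr_ge0 p.1) (normr_ge0 (p.2 - - mu ^- n)); nra.
Qed.

Lemma homoclinic_not_lattice p : homoclinic p -> ~ lattice p.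
Proof.
move=> [n pn] Lp; have := latticeB Lp pn; rewrite opprB addrC subrK => /lattice_small.
rewrite /= mulr0 normr0 ltr01 => /(_ isT)[] /eqP.
by rewrite gt_eqF// mu_expz_gt0.
Qed.

Lemma homoclinicD p l : lattice l -> homoclinic p -> homoclinic (p + l).
Proof.
by move=> Ll [n pn]; exists n; rewrite addrAC; exact: latticeD.
Qed.

Lemma homoclinic_mu (n : int) : homoclinic (mu ^ n, 0).
Proof. by exists n; rewrite subrr; exact: lattice0. Qed.

Lemma homoclinic_muV (n : int) : homoclinic (0, - mu ^ n).
Proof.
by exists (- n); rewrite pairB sub0r subr0 -[X in lattice X]opprK; apply: latticeN;
  rewrite -[X in (_, X)]opprK -[- (_, _)]/(- - _, - - _) !opprK -{2}[n]opprK; exact: lattice_unit.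
Qed.

Lemma countable_homoclinic : countable homoclinic.
Proof.
rewrite (_ : homoclinic = \bigcup_(n in [set: int]) ((fun l => l + (mu ^ n, 0)) @` lattice)).
  apply: bigcup_countable => // n _; apply: (sub_countable (card_image_le _ _)).
  exact: countable_lattice.
apply/seteqP; split => [p [n pn]|p [n _ [l Ll <-]]].
  by exists n => //; eexists; [exact: pn|rewrite subrK].
by exists n; rewrite addrK.
Qed.

Lemma countable_lattice_homoclinic : countable (lattice `|` homoclinic).
Proof.
rewrite -bigcup2E; apply: bigcup_countable => // -[|[|n]] _ /=.
- exact: countable_lattice.
- exact: countable_homoclinic.
- exact: countable0.
Qed.

Lemma linear_actionD (B : 'M[R]_2) p q :
  linear_action B (p + q) = linear_action B p + linear_action B q.
Proof. by rewrite /linear_action /=; congr pair => /=; ring. Qed.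

Lemma linear_actionN (B : 'M[R]_2) p : linear_action B (- p) = - linear_action B p.
Proof. by rewrite /linear_action /=; congr pair => /=; ring. Qed.

Lemma linear_actionB (B : 'M[R]_2) p q :
  linear_action B (p - q) = linear_action B p - linear_action B q.
Proof. by rewrite linear_actionD linear_actionN. Qed.

Lemma cvg_linear_action (B : 'M[R]_2) p : linear_action B q @[q --> p] --> linear_action B p.
Proof.
have c1 : (q.1 : R) @[q --> p] --> p.1 by exact: cvg_fst.
have c2 : (q.2 : R) @[q --> p] --> p.2 by exact: cvg_snd.
by apply: cvg_pairR; apply: cvgD; apply: cvgM => //; exact: cvg_cst.
Qed.

Lemma det2 (B : 'M[R]_2) : \det B = B 0 0 * B 1 1 - B 0 1 * B 1 0.
Proof.
by rewrite (expand_det_row _ 0) !big_ord_recl big_ord0 /cofactor !det_mx11 !mxE /=;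
  rewrite addr0 expr0 mul1r expr1 mulN1r mulrN; congr (_ * B _ _ - B _ _ * B _ _); apply/val_inj.
Qed.

(** Points of the orbit close to 0 on the two rays are mapped to points of the
    orbit close to 0, that is, to one of the two rays; so the columns of B are
    multiples of the basis vectors by powers of mu, up to sign. If both columns
    lie on the same axis the determinant vanishes, and if the rays are exchanged
    it is negative. In the remaining case B is diagonal with entries mu^k, mu^j;
    comparing B (1, 1) with (mu^k, mu^-k), both in the lattice, gives j = -k. *)
Lemma lattice_homoclinic_preserved (B : 'M[R]_2) : 0 < \det B ->
  (forall l, lattice l -> lattice (linear_action B l)) ->
  (forall p, homoclinic p -> homoclinic (linear_action B p)) ->
  exists k : int, [/\ B 0 0 = mu ^ k, B 0 1 = 0, B 1 0 = 0 & B 1 1 = mu ^ (- k)].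
Proof.
move=> detB BL BO.
have contract x : exists N : nat, ball (0 : R * R) 4^-1 (linear_action B (mu ^- N * x.1, mu ^- N * x.2)).
  have : (fun n : nat => linear_action B (mu ^- n * x.1, mu ^- n * x.2)) @ \oo --> (0 : R * R).
    have c : (fun n : nat => (mu ^- n * x.1, mu ^- n * x.2)) @ \oo --> (0 : R * R).
      rewrite -[0](_ : (0 * x.1, 0 * x.2) = 0 :> R * R); last by rewrite !mul0r.
      by apply: cvg_pairR => /=; (apply: cvgM; [exact: cvg_muVn|exact: cvg_cst]).
    have := cvg_comp _ _ c (@cvg_linear_action B 0).
    by rewrite (_ : linear_action B 0 = 0)// /linear_action /= !mulr0 addr0.
  move=> /cvg_ballP/(_ 4^-1); rewrite invr_gt0 => /(_ (ltr0n _ 4))[N _ /(_ N (leqnn _))] HN.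
  by exists N.
have mu0 : mu != 0 by rewrite lt0r_neq0// mu_gt0.
have scale N (a : R) n : a * mu ^- N = mu ^ n -> a = mu ^ (n + N).
  move=> e; apply: (mulIf (invr_neq0 (expf_neq0 N mu0))); rewrite e.
  by rewrite expfzDr// -exprnP mulfK// expf_neq0.
have scale0 N (a : R) : a * mu ^- N = 0 -> a = 0.
  by move=> /eqP; rewrite mulf_eq0 invr_eq0 expf_eq0 (negbTE mu0) andbF orbF => /eqP.
have col0 : exists k : int, (B 0 0 = mu ^ k /\ B 1 0 = 0) \/ (B 0 0 = 0 /\ B 1 0 = - mu ^ k).
  have [N /= ] := contract (1, 0); rewrite mulr1 mulr0 => HN.
  have /BO/homoclinic_near0 := homoclinic_mu (- N%:Z); rewrite -exprnN => /(_ HN)[n].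
  rewrite /linear_action /= !mulr0 !addr0 => -[[e1 e2]|[e1 e2]]; exists (n + N).
    by left; split; [exact: scale e1|exact: scale0 e2].
  right; split; first exact: scale0 e1.
  by rewrite -(scale N (- B 1 0) n) ?opprK// mulNr e2 opprK.
have col1 : exists k : int, (B 0 1 = - mu ^ k /\ B 1 1 = 0) \/ (B 0 1 = 0 /\ B 1 1 = mu ^ k).
  have [N /= ] := contract (0, -1); rewrite mulrN1 mulr0 => HN.
  have /BO/homoclinic_near0 := homoclinic_muV (- N%:Z); rewrite -exprnN => /(_ HN)[n].
  rewrite /linear_action /= !mulr0 !add0r => -[[e1 e2]|[e1 e2]]; exists (n + N).
    left; split; last by apply: (scale0 N); apply/eqP; rewrite -oppr_eq0 -mulrN e2.
    by rewrite -(scale N (- B 0 1) n) ?opprK// mulNr -mulrN.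
  right; split; first by apply: (scale0 N); apply/eqP; rewrite -oppr_eq0 -mulrN e1.
  by apply: scale; apply: oppr_inj; rewrite -mulrN.
move: detB; rewrite det2; case: col0 => k; case: col1 => j.
have pk := mu_expz_gt0 (R := R) k; have pj := mu_expz_gt0 (R := R) j.
case=> -[e1 e2] [[e3 e4]|[e3 e4]]; rewrite e1 e2 e3 e4 => detB.
- by move: detB; lra.
- by move: detB; nra.
- exists k; split => //.
  have := latticeB (BL _ (lattice_unit 0)) (lattice_unit k).
  rewrite /linear_action /= oppr0 !expr0z e1 e2 e3 e4 !mulr1 addr0 add0r pairB subrr.
  by move=> /lattice_small; rewrite /= mul0r normr0 ltr01 => /(_ isT)[] /subr0_eq.
- by move: detB; lra.
Qed.

End Orbit.

(** * The punctured torus *)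
Section Reduction.
Context {R : realType}.
Implicit Types (p q l z : R * R) (W : set (R * R)).

(** The coordinates of a point in the basis [lat 1 0], [lat 0 1]. *)
Definition coord1 p : R := (p.1 + p.2) / 2.
Definition coord2 p : R := (p.1 - p.2) / (2 * sqrt2).

Definition red p : R * R := p - lat (Num.floor (coord1 p)) (Num.floor (coord2 p)).

Lemma sqrt2_neq0 : sqrt2 != 0 :> R.
Proof. by rewrite gt_eqF// (lt_trans ltr01)// sqrt2_gt1. Qed.

Lemma coord1_lat p a b : coord1 (p + lat a b) = coord1 p + a%:~R.
Proof. by rewrite /coord1 /lat /=; field. Qed.

Lemma coord2_lat p a b : coord2 (p + lat a b) = coord2 p + b%:~R.
Proof. by rewrite /coord2 /lat /=; field; rewrite sqrt2_neq0. Qed.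

Lemma lattice_red p : lattice (p - red p).
Proof. by rewrite /red opprB addrC subrK; eexists; eexists. Qed.

Lemma latD a b c d : lat (a + c) (b + d) = lat a b + lat c d :> R * R.
Proof. by rewrite /lat !intrD; congr pair => /=; ring. Qed.

Lemma red_eq p q : lattice (p - q) -> red p = red q.
Proof.
move=> [a [b pq]]; have -> : p = q + lat a b by rewrite -pq addrC subrK.
rewrite /red coord1_lat coord2_lat !floorDrz ?intr_int// !intrKfloor latD.
by rewrite opprD addrACA subrr addr0.
Qed.

Lemma red_redE p : red (red p) = red p.
Proof. by apply: red_eq; rewrite -opprB; apply/latticeN/lattice_red. Qed.

Lemma lattice_redP p q : red p = red q -> lattice (p - q).
Proof.
move=> pq; have -> : p - q = (p - red p) - (q - red q).
  by rewrite pq; move: (red q) => r; rewrite opprB addrA subrK.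
by apply: latticeB; exact: lattice_red.
Qed.

Lemma lat00 : lat 0 0 = 0 :> R * R.
Proof. by rewrite /lat !mul0r addr0 subr0. Qed.

Lemma red0 : red 0 = 0.
Proof.
have c1 : coord1 0 = 0 by rewrite /coord1 /= addr0 mul0r.
have c2 : coord2 0 = 0 by rewrite /coord2 /= subrr mul0r.
by rewrite /red c1 c2 floor0 lat00 subr0.
Qed.

Lemma red_lattice l : lattice l -> red l = 0.
Proof. by move=> Ll; rewrite -red0; apply: red_eq; rewrite subr0. Qed.

Lemma redP p : red p = p <-> (0 <= coord1 p < 1) && (0 <= coord2 p < 1).
Proof.
split=> [rp|/andP[c1 c2]].
  have : lat (Num.floor (coord1 p)) (Num.floor (coord2 p)) = 0 :> R * R.
    by apply/oppr_inj/(addrI p); rewrite oppr0 addr0.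
  rewrite /lat => -[] e1 e2.
  have s0 := sqrt2_gt1 (R := R).
  have f1 : (Num.floor (coord1 p))%:~R = 0 :> R by lra.
  have f2 : (Num.floor (coord2 p))%:~R = 0 :> R by nra.
  have := floor_itv (coord1 p); have := floor_itv (coord2 p).
  by rewrite !intrD f1 f2 !add0r => -> ->.
have f1 : Num.floor (coord1 p) = 0 by apply: floor_def; rewrite add0r.
have f2 : Num.floor (coord2 p) = 0 by apply: floor_def; rewrite add0r.
by rewrite /red f1 f2 lat00 subr0.
Qed.

Lemma red_base_point : (red (2^-1, 2^-1) == (2^-1, 2^-1)) && ((2^-1, 2^-1) != 0 :> R * R).
Proof.
apply/andP; split; last by apply/eqP => -[] /eqP; rewrite invr_eq0 pnatr_eq0.
apply/eqP/redP; rewrite /coord1 /coord2 /= subrr mul0r lexx ltr01 !andbT.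
by apply/andP; split; lra.
Qed.

End Reduction.

(** A point of the torus minus the origin is represented by its reduced lift.
    The topology is not that of this subset of the plane but the quotient
    topology, introduced below. *)
Definition ptorus (R : realType) : Type :=
  {p : R * R | (red p == p) && (p != 0)}.

HB.instance Definition _ (R : realType) := Choice.on (ptorus R).
HB.instance Definition _ (R : realType) := SubType.on (ptorus R).

Section PuncturedTorus.
Context {R : realType}.
Implicit Types (p q l z : R * R) (W : set (R * R)) (x : ptorus R).

Definition base_point : ptorus R := Sub (2^-1, 2^-1) red_base_point.

HB.instance Definition _ := isPointed.Build (ptorus R) base_point.

Definition tproj p : ptorus R := insubd base_point (red p).

Lemma val_tproj p : ~ lattice p -> val (tproj p) = red p.
Proof.
move=> Lp; rewrite val_insubd red_redE eqxx/=.
case: eqVneq => // rp0; exfalso; apply: Lp.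
by rewrite -[p]subr0 -rp0; exact: lattice_red.
Qed.

Lemma red_val x : red (val x) = val x.
Proof. by case: x => /= p /andP[/eqP]. Qed.

Lemma lattice_val x : ~ lattice (val x).
Proof.
by case: x => /= p /andP[/eqP rp /eqP p0] /red_lattice; rewrite rp.
Qed.

Lemma tprojK x : tproj (val x) = x.
Proof. by apply: val_inj; rewrite val_tproj ?red_val//; exact: lattice_val. Qed.

Lemma tprojP p q : ~ lattice p -> ~ lattice q -> tproj p = tproj q <-> lattice (p - q).
Proof.
move=> Lp Lq; split=> [/(congr1 val)|/red_eq pq].
  by rewrite !val_tproj// => /lattice_redP.
by apply: val_inj; rewrite !val_tproj.
Qed.

Lemma lattice_val_tproj p : ~ lattice p -> lattice (val (tproj p) - p).
Proof.
by move=> Lp; rewrite val_tproj// -opprB; apply/latticeN/lattice_red.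
Qed.

Lemma lattice_shift l p : lattice l -> ~ lattice p -> ~ lattice (p + l).
Proof. by move=> Ll Lp Lpl; apply: Lp; rewrite -[p](addrK l); exact: latticeB. Qed.

(** The quotient topology of the plane minus the lattice. On the lattice [tproj]
    has a default value, hence the restriction to the complement. *)
Definition ptorus_open (U : set (ptorus R)) : Prop := open (~` lattice `&` tproj @^-1` U).

Lemma open_latticeC : open (~` @lattice R).
Proof.
rewrite openE => z /lattice_isolated[e e0 He].
apply/nbhs_ballP; exists e => // l zl Ll; exact: He zl.
Qed.

Lemma ptorus_openT : ptorus_open setT.
Proof. by rewrite /ptorus_open preimage_setT setIT; exact: open_latticeC. Qed.

Lemma ptorus_openI : setI_closed ptorus_open.
Proof. by move=> U V oU oV; rewrite /ptorus_open preimage_setI setIIr; exact: openI. Qed.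

Lemma ptorus_open_bigU (I : Type) (f : I -> set (ptorus R)) :
  (forall i, ptorus_open (f i)) -> ptorus_open (\bigcup_i f i).
Proof.
move=> fo; rewrite /ptorus_open preimage_bigcup setI_bigcupr.
by apply: bigcup_open => i _; exact: fo.
Qed.

HB.instance Definition _ :=
  isOpenTopological.Build (ptorus R) ptorus_openT ptorus_openI ptorus_open_bigU.

Lemma open_ptorusE (U : set (ptorus R)) : open U = open (~` lattice `&` tproj @^-1` U).
Proof. by []. Qed.

Lemma nbhs_tproj p (N : set (ptorus R)) : ~ lattice p -> nbhs (tproj p) N -> nbhs p (tproj @^-1` N).
Proof.
move=> Lp; rewrite nbhsE => -[U [oU Up] UN].
have : nbhs p (~` lattice `&` tproj @^-1` U) by apply: open_nbhs_nbhs; split.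
by apply: filterS => q [_ /UN].
Qed.

Lemma cvg_tproj p : ~ lattice p -> tproj q @[q --> p] --> tproj p.
Proof. by move=> Lp N; exact: nbhs_tproj. Qed.

Lemma open_translate l W : open W -> open ((fun p => p + l) @` W).
Proof.
move=> oW; rewrite (_ : _ @` _ = (fun p => p - l) @^-1` W).
  by apply: open_comp => // p _; apply: cvgB; [exact: cvg_id|exact: cvg_cst].
apply/seteqP; split=> [_ [p Wp <-]|p Wp] /=; first by rewrite addrK.
by exists (p - l) => //; rewrite subrK.
Qed.

Lemma tproj_preimage W : W `<=` ~` lattice ->
  ~` lattice `&` tproj @^-1` (tproj @` W) = \bigcup_(l in lattice) (fun p => p + l) @` W.
Proof.
move=> WL; apply/seteqP; split=> [p [Lp [q Wq qp]]|p [l Ll [q Wq <-]]] /=.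
  exists (p - q); last by exists q => //; rewrite addrC subrK.
  by apply/tprojP => //; exact: WL.
split; first by apply: lattice_shift => //; exact: WL.
exists q => //; apply/tprojP; [exact: WL|by apply: lattice_shift => //; exact: WL|].
by rewrite opprD addrA subrr sub0r; exact: latticeN.
Qed.

Lemma open_tproj W : W `<=` ~` lattice -> open W -> open (tproj @` W).
Proof.
move=> WL oW; rewrite open_ptorusE tproj_preimage//.
by apply: bigcup_open => l _; exact: open_translate.
Qed.

Lemma tproj_surj x : exists2 p, ~ lattice p & tproj p = x.
Proof. by exists (val x); [exact: lattice_val|exact: tprojK]. Qed.

Lemma nbhs_tproj_ball p (e : R) : 0 < e -> ~ lattice p ->
  nbhs (tproj p) (tproj @` (ball p e `&` ~` lattice)).
Proof.
move=> e0 Lp; apply: open_nbhs_nbhs; split.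
  apply: open_tproj => [q []//|].
  by apply: openI; [exact: ball_open|exact: open_latticeC].
by exists p => //; split => //; exact: ballxx.
Qed.

(** The class of p - q is not 0, so a ball around p - q avoids the lattice; balls of
    half that radius around p and q have disjoint images. *)
Lemma hausdorff_ptorus : hausdorff_space (ptorus R).
Proof.
move=> x y; case: (tproj_surj x) => p Lp <-; case: (tproj_surj y) => q Lq <- pq.
apply/tprojP => //; apply: contrapT => /lattice_isolated[e e0 He].
have e20 : 0 < e / 2 by rewrite divr_gt0.
have [_ [[p' [pp' Lp'] <-] [q' [qq' Lq'] /tprojP]]] :=
  pq _ _ (nbhs_tproj_ball e20 Lp) (nbhs_tproj_ball e20 Lq).
move=> /(_ Lq' Lp') /latticeN; rewrite opprB => /He; apply.
move: pp' qq'; rewrite -!ball_normE/= => pp' qq'.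
rewrite (_ : p - q - (p' - q') = (p - p') - (q - q')); last first.
  by rewrite !opprB [q' - p']addrC addrACA [- q + q']addrC.
by rewrite [e]splitr; apply: le_lt_trans (ler_normB _ _) _; exact: ltrD.
Qed.

End PuncturedTorus.

(** * Connectedness of the plane minus a countable set *)
Section Plane.
Context {R : realType}.
Implicit Types (p q l z : R * R).

Lemma exists_notin_countable (C : set R) : countable C -> exists t, ~ C t.
Proof.
move=> Cc; apply: contrapT => /forallNP CT.
have CE : C = setT by apply/seteqP; split => // t _; have /contrapT := CT t.
have : lebesgue_measure ([set` `[0, 1]] : set R) = 0%E.
  apply: countable_lebesgue_measure0; apply: sub_countable Cc; rewrite CE.
  exact: subset_card_le.
rewrite lebesgue_measure_itv/= lte_fin ltr01 oppr0 adde0 => /eqP.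
by rewrite eqe oner_eq0.
Qed.

Definition segment p q : set (R * R) :=
  (fun s : R => (p.1 + s * (q.1 - p.1), p.2 + s * (q.2 - p.2))) @` `[0, 1].

Lemma connected_segment p q : connected (segment p q).
Proof.
apply: connected_continuous_connected; first exact: segment_connected.
apply: continuous_subspaceT => s; apply: cvg_pairR => /=;
  by apply: cvgD; [exact: cvg_cst|apply: cvgM; [exact: cvg_id|exact: cvg_cst]].
Qed.

Lemma segmentl p q : segment p q p.
Proof.
exists 0; first by rewrite /= in_itv/= lexx ler01.
by rewrite !mul0r !addr0; case: p.
Qed.

Lemma segmentr p q : segment p q q.
Proof.
exists 1; first by rewrite /= in_itv/= lexx ler01.
by rewrite !mul1r !subrKC; case: q.
Qed.

(** Two points x, y outside C are joined by broken lines through the points m_t of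
    the perpendicular bisector of the segment from x to y. The first segments of
    these lines meet only in x and the last ones only in y, so each point of C
    excludes at most two values of t, and some t is not excluded. *)
Lemma connected_countableC (C : set (R * R)) : countable C -> connected (~` C).
Proof.
move=> Cc.
have [[x Cx]|noC] := pselect ((~` C) !=set0); last first.
  by move/nonemptyPn: noC => ->; exact: connected0.
suff join y : ~ C y -> exists z, segment x z `|` segment z y `<=` ~` C.
  have -> : ~` C = \bigcup_(P in [set P | [/\ P x, connected P & P `<=` ~` C]]) P.
    apply/seteqP; split=> [y Cy|y [P [_ _ PC] Py]]; last exact: PC.
    have [z zC] := join y Cy.
    exists (segment x z `|` segment z y); last by right; exact: segmentr.
    split => //; first by left; exact: segmentl.
    apply: connectedU; [|exact: connected_segment|exact: connected_segment].
    by exists z; split; [exact: segmentr|exact: segmentl].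
  apply: bigcup_connected => [|P []//].
  by exists x => P [].
move=> Cy.
have [<-|/eqP xy] := eqVneq x y.
  exists x => z [] [s _ <-]; rewrite !subrr !mulr0 !addr0; by case: x Cx.
pose d := y - x.
(* With n the vector d turned by a right angle, f p (p + s (d / 2 + u n)) = u for
   s <> 0; the line to m_t has u = t from x, and u = - t from y. *)
pose f (p c : R * R) := ((c.2 - p.2) * d.1 - (c.1 - p.1) * d.2) /
  (2 * ((c.1 - p.1) * d.1 + (c.2 - p.2) * d.2)).
have [t] : exists t, ~ (f x @` C `|` (fun c => - f y c) @` C) t.
  apply: exists_notin_countable; rewrite -bigcup2E.
  apply: bigcup_countable => // -[|[|n]] _ /=; last exact: countable0.
    exact: sub_countable (card_image_le _ _) Cc.
  exact: sub_countable (card_image_le _ _) Cc.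
move=> /not_orP[tx ty].
have d0 : 0 < d.1 ^+ 2 + d.2 ^+ 2.
  rewrite lt_neqAle addr_ge0 ?sqr_ge0// andbT eq_sym paddr_eq0 ?sqr_ge0// !sqrf_eq0.
  apply/negP => /andP[/eqP d1 /eqP d2]; apply: xy; apply/esym/eqP.
  by rewrite -subr_eq0 -/d; apply/eqP; case: (d) d1 d2 => ? ? /= -> ->.
pose m := (x.1 + d.1 / 2 - t * d.2, x.2 + d.2 / 2 + t * d.1).
have yE : y = (x.1 + d.1, x.2 + d.2) by rewrite /d /=; case: (y) => a b /=; congr pair; ring.
have y1 : y.1 = x.1 + d.1 by rewrite {1}yE.
have y2 : y.2 = x.2 + d.2 by rewrite {1}yE.
clearbody d; clear yE.
have nD : d.1 * d.1 + d.2 * d.2 != 0 by rewrite -!expr2 gt_eqF.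
have fE (p c : R * R) (s u : R) : s != 0 -> c.1 - p.1 = s * (d.1 / 2 - u * d.2) ->
    c.2 - p.2 = s * (d.2 / 2 + u * d.1) -> f p c = u.
  move=> s0 e1 e2; rewrite /f e1 e2; case: (d) nD => /= a b ab0.
  have -> : 2 * (s * (a / 2 - u * b) * a + s * (b / 2 + u * a) * b) =
    s * (a * a + b * b) by field.
  have -> : s * (b / 2 + u * a) * a - s * (a / 2 - u * b) * b =
    u * (s * (a * a + b * b)) by field.
  by rewrite mulfK// mulf_neq0.
exists m => c [] [s _ <-] /= Cm.
- apply: tx; eexists; first exact: Cm.
  apply: (@fE _ _ s) => /=.
  + by apply: contra_notN Cx => /eqP s0; move: Cm; rewrite s0 !mul0r !addr0; case: (x).
  + by rewrite /m /=; ring.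
  + by rewrite /m /=; ring.
- apply: ty; eexists; first exact: Cm.
  rewrite (@fE _ _ (s - 1) (- t)) ?opprK//=.
  + apply: contra_notN Cy; rewrite subr_eq0 => /eqP s0; move: Cm; rewrite s0 !mul1r.
    by rewrite !subrKC; case: (y).
  + by rewrite y1; field.
  + by rewrite y2; field.
Qed.

End Plane.

(** * Countable basis and area of the plane *)
Section PlaneMeasure.
Context {R : realType}.
Implicit Types (p q l z : R * R) (U : set (R * R)).

Definition rat_ball (i : rat * rat * rat) : set (R * R) :=
  ball (ratr i.1.1 : R, ratr i.1.2 : R) (ratr i.2 : R).

Lemma rat_approx (x e : R) : 0 < e -> exists q : rat, `|x - ratr q| < e.
Proof.
move=> e0; have /rat_in_itvoo[q /itvP xq] : x - e < x + e by lra.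
by exists q; rewrite ltr_distlC !xq.
Qed.

Lemma nbhs_rat_ball p U : nbhs p U -> exists i, rat_ball i p /\ rat_ball i `<=` U.
Proof.
move=> /nbhs_ballP[e /= e0 pU].
have /rat_in_itvoo[r /itvP r0] : 0 < e / 2 by rewrite divr_gt0.
have r0' : 0 < ratr r :> R by rewrite r0.
have [q1 h1] := rat_approx p.1 r0'; have [q2 h2] := rat_approx p.2 r0'.
have pi : rat_ball ((q1, q2), r) p by split => /=; rewrite /ball/= distrC.
exists ((q1, q2), r); split => // z zi; apply: pU.
have re : (ratr r : R) + ratr r <= e by rewrite [e]splitr lerD// ltW// r0.
by apply: le_ball re _ _; apply: ball_triangle zi; exact: ball_sym.
Qed.

Lemma open_rat_ballE U : open U ->
  U = \bigcup_i (if `[< rat_ball i `<=` U >] then rat_ball i else set0).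
Proof.
move=> oU; apply/seteqP; split=> [p Up|p [i _]].
  have [i [pi iU]] := nbhs_rat_ball (open_nbhs_nbhs (conj oU Up)).
  by exists i => //; case: asboolP.
by case: asboolP => // iU /iU.
Qed.

Notation plane := (measurableTypeR R * measurableTypeR R)%type.

Lemma measurable_ball_plane p (r : R) : measurable (ball p r : set plane).
Proof.
rewrite (_ : ball p r = ball p.1 r `*` ball p.2 r)//.
by apply: measurableX; rewrite ball_itv; exact: measurable_itv.
Qed.

Lemma measurable_open_plane U : open U -> measurable (U : set plane).
Proof.
move=> /open_rat_ballE ->; apply: countable_bigcupT_measurable => // i.
by case: ifP => _; [exact: measurable_ball_plane|exact: measurable0].
Qed.

Lemma measurable_translateR (v : R) :
  measurable_fun setT ((fun x => x + v) : measurableTypeR R -> measurableTypeR R).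
Proof. by apply: measurable_funD => //; exact: measurable_cst. Qed.

Lemma lebesgue_translate (v : R) (A : set (measurableTypeR R)) : measurable A ->
  lebesgue_measure ((fun x => x + v) @^-1` A) = lebesgue_measure A.
Proof.
move=> mA; have mv := measurable_translateR v.
rewrite -[LHS]/(pushforward lebesgue_measure ((fun x => x + v) : measurableTypeR R -> measurableTypeR R) A).
apply/esym/lebesgue_measure_unique => //= _ [[a b] _ <-] /=.
rewrite /pushforward (_ : _ @^-1` _ = `](a - v), (b - v)]%classic).
  rewrite !lebesgue_measure_itv/= !lte_fin ltrD2r; case: ifP => // _.
  by rewrite -!EFinB; congr EFin; rewrite opprB addrA subrK.
by apply/seteqP; split=> x /=; rewrite !in_itv/= ltrBlDr lerBrDr.
Qed.

Lemma measurable_translate l : measurable_fun setT ((fun p => p + l) : plane -> plane).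
Proof.
apply: measurable_fun_pair => /=.
  by apply: (@measurable_funD _ _ _ _ fst (cst l.1)) => //; exact: measurable_fst.
by apply: (@measurable_funD _ _ _ _ snd (cst l.2)) => //; exact: measurable_snd.
Qed.

Lemma area_translate l (A : set plane) : measurable A ->
  plane_area ((fun p => p + l) @^-1` A) = plane_area A.
Proof.
move=> mA; have ml := measurable_translate l.
rewrite -[LHS]/(pushforward (lebesgue_measure \x lebesgue_measure)%E ((fun p => p + l) : plane -> plane) A).
apply/esym/product_measure_unique => //= X Y mX mY.
rewrite /pushforward (_ : _ @^-1` _ = ((fun x => x + l.1) @^-1` X) `*` ((fun x => x + l.2) @^-1` Y))//.
have mt (v : R) (Z : set (measurableTypeR R)) : measurable Z -> measurable ((fun x => x + v) @^-1` Z : set (measurableTypeR R)).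
  move=> mZ; rewrite -[X in measurable X]setTI.
  exact: measurable_translateR.
rewrite product_measure1E; [|exact: mt|exact: mt].
by congr (_ * _)%E; exact: lebesgue_translate.
Qed.

Lemma measurable_translate_preimage l (A : set plane) : measurable A ->
  measurable ((fun p => p + l) @^-1` A : set plane).
Proof.
by move=> mA; rewrite -[X in measurable X]setTI; exact: measurable_translate.
Qed.

Lemma countable_measurable_plane (A : set plane) : countable A -> measurable A.
Proof.
apply: countable_measurable => -[a b].
rewrite (_ : [set (a, b)] = [set a] `*` [set b]); first exact: measurableX.
by apply/seteqP; split=> [_ ->|[x y] /= [-> ->]].
Qed.

Lemma countable_area0 (A : set plane) : countable A -> plane_area A = 0%E.
Proof.
move=> cA.
have c1 : countable [set p.1 | p in A] by exact: sub_countable (card_image_le _ _) cA.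
have m1 : measurable ([set p.1 | p in A] : set (measurableTypeR R)).
  by apply: countable_measurable => // x; exact: measurable_set1.
apply/eqP; rewrite eq_le measure_ge0 andbT.
have <- : plane_area ([set p.1 | p in A] `*` setT : set plane) = 0%E.
  rewrite /plane_area product_measure1E//.
  by rewrite [X in (X * _)%E](countable_lebesgue_measure0 c1) mul0e.
apply: le_measure => //; rewrite ?inE.
- exact: countable_measurable_plane.
- by apply: measurableX.
- by move=> p Ap; split => //; exists p.
Qed.

End PlaneMeasure.

(** * The translation surface *)
Section Surface.
Context {R : realType}.
Implicit Types (p q l z : R * R) (W : set (R * R)) (x y : ptorus R).

Definition marked : set (ptorus R) := tproj @` homoclinic.

Lemma markedP p : ~ lattice p -> marked (tproj p) <-> homoclinic p.
Proof.
move=> Lp; split=> [[q Oq /tprojP qp]|Op]; last by exists p.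
have Lq := homoclinic_not_lattice Oq.
by have := homoclinicD (latticeN (qp Lq Lp)) Oq; rewrite opprB addrC subrK.
Qed.

Lemma marked_val x : marked x <-> homoclinic (val x).
Proof. by rewrite -{1}[x]tprojK; apply: markedP; exact: lattice_val. Qed.

Lemma open_homoclinicC : open (~` lattice `&` ~` homoclinic : set (R * R)).
Proof.
rewrite openE => z [Lz Oz]; have [e e0 He] := homoclinic_isolated Lz.
apply: filterI; first exact: open_nbhs_nbhs (conj open_latticeC Lz).
apply/nbhs_ballP; exists e => // p zp Op; apply: Oz.
by rewrite -(He _ Op zp).
Qed.

(** Balls have radius 1/4 so that the difference of two of their points has norm
    less than 1/4: the projection is injective on them. *)
Lemma ball_lattice_inj z p q : ball z 4^-1 p -> ball z 4^-1 q -> lattice (p - q) -> p = q.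
Proof.
move=> [/= p1 p2] [/= q1 q2] Lpq; apply/eqP; rewrite -subr_eq0; apply/eqP.
apply: lattice_small => //=.
have h1 : `|p.1 - q.1| < 2^-1.
  move: p1 q1; rewrite /ball/= !ltr_norml => /andP[? ?] /andP[? ?].
  by apply/andP; split; lra.
have h2 : `|p.2 - q.2| < 2^-1.
  move: p2 q2; rewrite /ball/= !ltr_norml => /andP[? ?] /andP[? ?].
  by apply/andP; split; lra.
by rewrite normrM; move: h1 h2 (normr_ge0 (p.1 - q.1)) (normr_ge0 (p.2 - q.2)); nra.
Qed.

(** The inverse of the projection on W, when the projection is injective there. *)
Definition sheet W x : R * R := xget 0 [set p | W p /\ tproj p = x].

Section SmallChart.
Variables (W : set (R * R)) (z : R * R).
Hypotheses (oW : open W) (WL : W `<=` ~` lattice) (Wz : W `<=` ball z 4^-1).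

Lemma sheet_tproj p : W p -> sheet W (tproj p) = p.
Proof.
move=> Wp; rewrite /sheet; case: xgetP => [q _ [Wq qp]|/(_ p)[]//].
apply: (ball_lattice_inj (Wz Wq) (Wz Wp)); apply/tprojP => //; exact: WL.
Qed.

Lemma open_small_dom : open (tproj @` W).
Proof. exact: open_tproj. Qed.

Lemma sheet_continuous : {within tproj @` W, continuous (sheet W)}.
Proof.
rewrite continuous_open_subspace; last exact: open_small_dom.
move=> _ /set_mem[p Wp <-] N; rewrite sheet_tproj// nbhsE => -[V [oV Vp] VN].
have : nbhs (tproj p) (tproj @` (W `&` V)).
  apply: open_nbhs_nbhs; split; last by exists p.
  by apply: open_tproj => [q [/WL]//|]; exact: openI.
by apply: filterS => _ [q [Wq Vq] <-] /=; rewrite sheet_tproj//; exact: VN.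
Qed.

Lemma sheet_inj : {in tproj @` W &, injective (sheet W)}.
Proof.
by move=> _ _ /set_mem[p Wp <-] /set_mem[q Wq <-]; rewrite !sheet_tproj// => ->.
Qed.

Lemma sheet_open_map (V : set (ptorus R)) : V `<=` tproj @` W -> open V -> open (sheet W @` V).
Proof.
move=> VW oV; rewrite (_ : _ @` _ = W `&` (~` lattice `&` tproj @^-1` V)).
  by apply: openI => //; rewrite -open_ptorusE.
apply/seteqP; split=> [_ [x Vx <-]|p [Wp [_ Vp]]].
  by have [p Wp px] := VW x Vx; rewrite -px sheet_tproj//; split => //; split; [exact: WL|rewrite /= px].
by exists (tproj p) => //; exact: sheet_tproj.
Qed.

Definition small_chart : chart R (ptorus R) :=
  Chart open_small_dom sheet_continuous sheet_inj sheet_open_map.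

End SmallChart.

(** All sections with values in a ball of radius 1/4 are allowed, not only those
    of a chosen family: the radius alone makes two of them differ by a
    translation. *)
Definition local_section (c : chart R (ptorus R)) : Prop :=
  exists z, forall x, chart_dom c x -> [/\ ball z 4^-1 (c x), ~ lattice (c x) & tproj (c x) = x].

Definition flat_atlas : set (chart R (ptorus R)) :=
  [set c | chart_dom c `<=` ~` marked /\ local_section c].

Lemma local_section_at W p : open W -> W `<=` ~` lattice -> W p ->
  exists c : chart R (ptorus R), [/\ local_section c, chart_dom c `<=` tproj @` W,
    chart_dom c (tproj p) & \forall q \near p, chart_dom c (tproj q) /\ c (tproj q) = q].
Proof.
move=> oW WL Wp.
pose V := ball p 4^-1 `&` W.
have oV : open V by apply: openI => //; exact: ball_open.
have Vp : V p by split => //; apply: ballxx.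
have VL : V `<=` ~` lattice by move=> q [_ /WL].
have Vz : V `<=` ball p 4^-1 by move=> q [].
exists (small_chart oV VL Vz); split.
- exists p => _ [q Vq <-] /=; rewrite (sheet_tproj VL Vz)//.
  by split; [exact: Vz|exact: VL|].
- by move=> _ [q [_ Wq] <-]; exists q.
- by exists p.
- near=> q; have Vq : V q by near: q; apply: open_nbhs_nbhs.
  by split; [exists q|exact: (sheet_tproj VL Vz)].
Unshelve. all: by end_near. Qed.

(** Two lifts of a point differ by a lattice vector; as both charts have values in
    small balls, the vectors obtained at two points differ by a vector of norm
    less than 1. *)
Lemma local_section_translation (c d : chart R (ptorus R)) :
  local_section c -> local_section d ->
  exists v, forall x, chart_dom c x -> chart_dom d x -> d x = c x + v.
Proof.
move=> [z cz] [w dw].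
have [[x0 [cx0 dx0]]|none] := pselect (exists x, chart_dom c x /\ chart_dom d x); last first.
  by exists 0 => x cx dx; exfalso; apply: none; exists x.
exists (d x0 - c x0) => x cx dx.
have [[/= c1 c2] Lc pc] := cz _ cx; have [[/= d1 d2] Ld pd] := dw _ dx.
have [[/= c3 c4] Lc0 pc0] := cz _ cx0; have [[/= d3 d4] Ld0 pd0] := dw _ dx0.
have L1 : lattice (d x - c x) by apply/tprojP => //; rewrite pc.
have L2 : lattice (d x0 - c x0) by apply/tprojP => //; rewrite pc0.
suff : (d x - c x) - (d x0 - c x0) = 0.
  by move/subr0_eq => <-; rewrite addrC subrK.
apply: lattice_small; first exact: latticeB.
move: c1 c2 c3 c4 d1 d2 d3 d4; rewrite /ball/= !ltr_norml.
move=> /andP[? ?] /andP[? ?] /andP[? ?] /andP[? ?] /andP[? ?] /andP[? ?] /andP[? ?] /andP[? ?].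
have small (a b : R) : `|a| < 1 -> `|b| < 1 -> `|a * b| < 1.
  by rewrite normrM => ? ?; have := normr_ge0 a; have := normr_ge0 b; nra.
rewrite -ltr_norml; apply: small; rewrite ltr_norml /=; apply/andP; split; lra.
Qed.

Lemma ptorus_connected : connected [set: ptorus R].
Proof.
have <- : tproj @` (~` lattice) = [set: ptorus R].
  by apply/seteqP; split => // x _; have [p Lp <-] := tproj_surj x; exists p.
apply: connected_continuous_connected.
  by apply: connected_countableC; exact: countable_lattice.
rewrite continuous_open_subspace; last exact: open_latticeC.
by move=> p /set_mem; exact: cvg_tproj.
Qed.

Lemma ptorus_second_countable : @second_countable (ptorus R).
Proof.
exists ((fun i => tproj @` (rat_ball i `&` ~` lattice)) @` setT).
  by apply: sub_countable (card_image_le _ _) _.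
split=> [_ [i _ <-]|x N].
  apply: open_tproj => [p []//|]; apply: openI; last exact: open_latticeC.
  exact: ball_open.
have [p Lp <-] := tproj_surj x => /(nbhs_tproj Lp)/nbhs_rat_ball[i [ip iN]].
exists (tproj @` (rat_ball i `&` ~` lattice)).
  by split; [exists i|exists p].
by move=> _ [q [/iN iq _] <-].
Qed.

Lemma local_section_cover :
  charts_cover [set: ptorus R] [set c | local_section c].
Proof.
apply/seteqP; split => // x _; have [p Lp <-] := tproj_surj x.
have [c [c1 _ c2 _]] := local_section_at open_latticeC (fun q => id) Lp.
by exists c.
Qed.

Lemma ptorus_surface : topological_surface R (ptorus R).
Proof.
split; [exact: hausdorff_ptorus|exact: ptorus_second_countable|].
apply/seteqP; split => // x _.
have : [set: ptorus R] x by [].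
by rewrite -[X in X x]local_section_cover => -[c _ cx]; exists c.
Qed.

(** A transition map is a translation near each point, so it turns a circle with
    the identity as choice of the argument. *)
Lemma ptorus_orientable : orientable R (ptorus R).
Proof.
exists [set c | local_section c]; first exact: local_section_cover.
move=> c d lc ld x cx dx.
have [v cdv] := local_section_translation lc ld.
have tr y : chart_dom c y -> chart_dom d y -> transition c d (c y) = c y + v.
  move=> cy dy; rewrite /transition pinvKV ?inE//; first exact: cdv.
  exact: chart_inj.
have oc : open (c @` (chart_dom c `&` chart_dom d)).
  apply: chart_open_map => [y []//|]; apply: openI; exact: chart_dom_open.
have : nbhs (c x) (c @` (chart_dom c `&` chart_dom d)).
  by apply: open_nbhs_nbhs; split => //; exists x.
move=> /nbhs_ballP[e /= e0 He]; exists e => // r /andP[r0 re].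
exists idfun; split => [s|/=|t _]; [exact: cvg_id|by rewrite add0r|].
exists r => //.
have [y [cy dy] yE] : (c @` (chart_dom c `&` chart_dom d)) (polar (c x) r t).
  apply: He; split; rewrite /ball/= opprD addrA subrr sub0r normrN normrM gtr0_norm//.
    by apply: le_lt_trans re; rewrite ler_piMr ?(ltW r0)// cos_max.
  by apply: le_lt_trans re; rewrite ler_piMr ?(ltW r0)// sin_max.
by rewrite -yE !tr// yE /polar /=; congr pair => /=; rewrite addrAC.
Qed.

Lemma marked_isolated : isolated marked = marked.
Proof.
apply/seteqP; split=> [x /isolatedS//|_ [p Op <-]].
have Lp := homoclinic_not_lattice Op.
split; first by rewrite inE; exists p.
have [e e0 He] := homoclinic_isolated Lp.
exists (tproj @` (ball p e `&` ~` lattice)); first exact: nbhs_tproj_ball.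
apply/seteqP; split=> [_ [[q [pq Lq] <-] /(markedP Lq)/He]|_ ->].
  by move=> /(_ pq) ->.
split; last by exists p.
by exists p => //; split => //; exact: ballxx.
Qed.

Lemma flat_atlas_cover : charts_cover (~` marked) flat_atlas.
Proof.
apply/seteqP; split=> [x [c [cm _] /cm]//|x].
have [p Lp <-] := tproj_surj x => /(contra_not (markedP Lp).2) Op.
have [|c [c1 c2 c3 _]] := local_section_at open_homoclinicC _ (conj Lp Op).
  by move=> q [].
exists c => //; split => // _ /c2[q [Lq Oq] <-].
by move=> /(markedP Lq).
Qed.

Lemma flat_atlas_translation (c d : chart R (ptorus R)) : flat_atlas c -> flat_atlas d ->
  exists v, forall x, chart_dom c x -> chart_dom d x -> d x = c x + v.
Proof. by move=> [_ lc] [_ ld]; exact: local_section_translation. Qed.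

Definition marked_torus : translation_surface R :=
  @TranslationSurface R (ptorus R) marked flat_atlas ptorus_connected
    ptorus_surface ptorus_orientable marked_isolated flat_atlas_cover flat_atlas_translation.

End Surface.

(** * Finite area *)
Section Area.
Context {R : realType}.
Implicit Types (p q l z : R * R) (W : set (R * R)) (x y : ptorus R).
Notation plane := (measurableTypeR R * measurableTypeR R)%type.

Definition fundamental : set plane := [set p | (red p == p) && (p != 0)].

Lemma measurable_strip (f : R * R -> R) : continuous f ->
  measurable (f @^-1` `[0, 1[ : set plane).
Proof.
move=> cf; rewrite (_ : _ @^-1` _ = f @^-1` `]-oo, 1[ `\` f @^-1` `]-oo, 0[).
  by apply: measurableD; apply: measurable_open_plane; apply: open_comp => // p _; exact: cf.
apply/seteqP; split=> p /=; rewrite !in_itv/=.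
  by move=> /andP[p0 p1]; split => //; rewrite ltNge p0.
by move=> [p1 /negP]; rewrite -leNgt => ->.
Qed.

Lemma continuous_coord1 : continuous (@coord1 R).
Proof.
move=> p; apply: cvgM; last exact: cvg_cst.
by apply: cvgD; [exact: cvg_fst|exact: cvg_snd].
Qed.

Lemma continuous_coord2 : continuous (@coord2 R).
Proof.
move=> p; apply: cvgM; last exact: cvg_cst.
by apply: cvgB; [exact: cvg_fst|exact: cvg_snd].
Qed.

Lemma measurable_fundamental : measurable fundamental.
Proof.
rewrite (_ : fundamental = (@coord1 R @^-1` `[0, 1[ `&` @coord2 R @^-1` `[0, 1[) `\ 0).
  apply: measurableD; last by apply: countable_measurable_plane.
  by apply: measurableI; apply: measurable_strip; [exact: continuous_coord1|exact: continuous_coord2].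
apply/seteqP; split=> p /=; rewrite !in_itv/=.
  by move=> /andP[/eqP/redP/andP[? ?] /eqP ?].
move=> [[c1 c2] p0]; apply/andP; split; last exact/eqP.
by apply/eqP/redP; rewrite c1 c2.
Qed.

Lemma fundamental_lattice p : fundamental p -> ~ lattice p.
Proof. by move=> /andP[/eqP rp /eqP p0] /red_lattice; rewrite rp. Qed.

Lemma fundamental_area : (plane_area fundamental < +oo)%E.
Proof.
pose box : set plane := `[-3, 3] `*` `[-3, 3].
apply: (@le_lt_trans _ _ (plane_area box)).
  apply: le_measure; rewrite ?inE; first exact: measurable_fundamental.
    by apply: measurableX.
  move=> p /andP[/eqP/redP + _]; rewrite /coord1 /coord2 => /andP[/andP[c1 c2] /andP[c3 c4]].
  have s1 := sqrt2_gt1 (R := R); have s2 := sqrt2_lt2 (R := R).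
  have s0 : 0 < 2 * sqrt2 :> R by lra.
  move: c3 c4; rewrite ler_pdivlMr// ltr_pdivrMr// mul0r mul1r => c3 c4.
  by split; rewrite /= in_itv/=; apply/andP; split; lra.
rewrite /plane_area product_measure1E//.
rewrite [X in (X * _)%E]lebesgue_measure_itv [X in (_ * X)%E]lebesgue_measure_itv/=.
by rewrite lte_fin; case: ifP => _; rewrite ?mul0e// -?EFinN -?EFinD -EFinM ltry.
Qed.

Notation ptorusB := (g_sigma_algebraType (@open (ptorus R))).

Lemma measurable_tproj : measurable_fun setT (tproj : plane -> ptorusB).
Proof.
refine (@measurability _ _ plane ptorusB setT tproj (@open (ptorus R)) _ _) => //.
move=> _ [U oU <-]; rewrite setTI.
rewrite (_ : _ @^-1` _ = (~` lattice `&` tproj @^-1` U) `|` (lattice `&` tproj @^-1` U)).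
  apply: measurableU; first by apply: measurable_open_plane; rewrite -open_ptorusE.
  apply: countable_measurable_plane; apply: sub_countable countable_lattice.
  exact: subset_card_le.
by rewrite -setIUl setUCl setTI.
Qed.

Lemma ptorus_area_exists : exists m : {measure set ptorusB -> \bar R},
  forall B, m B = plane_area (tproj @^-1` B `&` fundamental).
Proof.
unshelve refine (ex_intro _ (pushforward
  (mrestr (lebesgue_measure \x lebesgue_measure)%E measurable_fundamental)
  (tproj : plane -> ptorusB) : {measure set ptorusB -> \bar R}) _).
  exact: measurable_tproj.
by [].
Qed.

(** An enumeration of the lattice by nat without repetition, since countable
    additivity is stated for sequences. *)
Definition lattice_enum (n : nat) : option (R * R) :=
  omap (fun ab : int * int => lat ab.1 ab.2) (pickle_inv n).

Lemma lat_inj (a b c d : int) : lat a b = lat c d :> R * R -> (a, b) = (c, d).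
Proof.
move=> abcd; have := congr1 coord1 abcd; have := congr1 coord2 abcd.
rewrite -[lat a b]add0r -[lat c d]add0r !coord1_lat !coord2_lat.
by move=> /addrI/intr_inj -> /addrI/intr_inj ->.
Qed.

Lemma lattice_enum_inj n m l : lattice_enum n = Some l -> lattice_enum m = Some l -> n = m.
Proof.
rewrite /lattice_enum.
case En: (pickle_inv n) => [[a b]|]//= [<-]; case Em: (pickle_inv m) => [[c d]|]//= /Some_inj/lat_inj e.
have := @pickle_invK (int * int)%type n; have := @pickle_invK (int * int)%type m.
by rewrite /ocancel En Em /= e => <- <-.
Qed.

Lemma lattice_enum_surj l : lattice l -> exists n, lattice_enum n = Some l.
Proof.
by move=> [a [b ->]]; exists (pickle (a, b)); rewrite /lattice_enum pickleK_inv.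
Qed.

Lemma lattice_enumP n l : lattice_enum n = Some l -> lattice l.
Proof. by rewrite /lattice_enum; case: pickle_inv => [[a b]|]//= [<-]; exists a, b. Qed.

(** The set C is cut by the translates of the fundamental domain; moving each
    piece by its lattice vector tiles the part of the fundamental domain lying
    over the image of C. *)
Lemma area_fold (C : set plane) : measurable C -> C `<=` ~` lattice ->
  (forall p q, C p -> C q -> lattice (p - q) -> p = q) ->
  plane_area (tproj @^-1` (tproj @` C) `&` fundamental) = plane_area C.
Proof.
move=> mC CL Cinj.
pose F n : set plane := if lattice_enum n is Some l
  then fundamental `&` (fun p => p + - l) @^-1` C else set0.
pose G n : set plane := if lattice_enum n is Some l
  then (fun p => p + l) @^-1` fundamental `&` C else set0.
have mF n : measurable (F n).
  rewrite /F; case: lattice_enum => // l; apply: measurableI.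
    exact: measurable_fundamental.
  exact: measurable_translate_preimage.
have mG n : measurable (G n).
  rewrite /G; case: lattice_enum => // l; apply: measurableI => //.
  by apply: measurable_translate_preimage; exact: measurable_fundamental.
have FG n : plane_area (F n) = plane_area (G n).
  have := mF n; rewrite /F /G; case: lattice_enum => // l mFn.
  rewrite -(area_translate l mFn); congr plane_area.
  by apply/seteqP; split=> p /=; rewrite addrK.
have tF : trivIset setT F.
  apply/trivIsetP => n m _ _ nm; apply/seteqP; split => // p [].
  rewrite /F; case En: lattice_enum => [l|//] [_ /= Cl].
  case Em: lattice_enum => [k|//] [_ /= Ck].
  have : p - l = p - k.
    apply: Cinj => //; rewrite opprB addrC addrA subrK.
    by apply: latticeB; [exact: lattice_enumP Em|exact: lattice_enumP En].
  move=> /addrI/oppr_inj lk; rewrite -lk in Em.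
  by move: nm; rewrite (lattice_enum_inj En Em) eqxx.
have tG : trivIset setT G.
  apply/trivIsetP => n m _ _ nm; apply/seteqP; split => // p [].
  rewrite /G; case En: lattice_enum => [l|//] [/= /andP[/eqP rl _] _].
  case Em: lattice_enum => [k|//] [/= /andP[/eqP rk _] _].
  have : p + l = p + k.
    rewrite -rl -rk; apply: red_eq; rewrite opprD addrACA subrr add0r.
    by apply: latticeB; [exact: lattice_enumP En|exact: lattice_enumP Em].
  move=> /addrI lk; rewrite -lk in Em.
  by move: nm; rewrite (lattice_enum_inj En Em) eqxx.
have -> : tproj @^-1` (tproj @` C) `&` fundamental = \bigcup_n F n.
  apply/seteqP; split=> [p [[q Cq /tprojP qp] fp]|p [n _]].
    have /lattice_enum_surj[n En] : lattice (p - q).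
      by rewrite -opprB; apply: latticeN; apply: qp; [exact: CL|exact: fundamental_lattice].
    by exists n => //; rewrite /F En; split => //=; rewrite subKr.
  rewrite /F; case En: lattice_enum => [l|//] [fp /= Cp]; split => //.
  exists (p + - l) => //; apply/tprojP; [exact: CL|exact: fundamental_lattice|].
  by rewrite addrAC subrr sub0r; apply: latticeN; exact: lattice_enumP En.
have -> : C = \bigcup_n G n.
  apply/seteqP; split=> [p Cp|p [n _]]; last by rewrite /G; case: lattice_enum => [l []|].
  have := lattice_val_tproj (CL _ Cp); have := valP (tproj p).
  move: (val _) => q fq /lattice_enum_surj[n En].
  exists n => //; rewrite /G En; split => //=.
  by have -> : p + (q - p) = q by rewrite addrC subrK.
have sumE (H : nat -> set plane) : (forall n, measurable (H n)) -> trivIset setT H ->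
    plane_area (\bigcup_n H n) = (\sum_(n <oo | n \in [set: nat]) plane_area (H n))%E.
  by move=> mH; apply: (measure_bigcup (lebesgue_measure \x lebesgue_measure)%E).
rewrite [LHS](sumE F mF tF).
rewrite [RHS](sumE G mG tG).
clearbody F G.
apply: eq_eseriesr => n _.
by rewrite FG.
Qed.

Lemma marked_torus_finite_area : finite_area (@marked_torus R).
Proof.
have [m ptorus_areaE] := ptorus_area_exists; exists m; split; last first.
  by rewrite ptorus_areaE preimage_setT setTI; exact: fundamental_area.
split.
  rewrite ptorus_areaE; apply: countable_area0; apply: sub_countable (@countable_homoclinic R).
  apply: subset_card_le => p [mp fp]; apply/markedP => //; exact: fundamental_lattice.
move=> c [_ [z cz]] B mB Bc; rewrite ptorus_areaE.
have BE : tproj @` (c @` B) = B.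
  apply/seteqP; split=> [_ [_ [x Bx <-] <-]|x Bx]; first by have [_ _ ->] := cz _ (Bc _ Bx).
  by exists (c x); [exists x|have [_ _ ->] := cz _ (Bc _ Bx)].
rewrite -{1}BE; apply: area_fold.
- rewrite (_ : c @` B = c @` chart_dom c `&` tproj @^-1` B).
    apply: measurableI.
      apply: measurable_open_plane; apply: chart_open_map => //.
      exact: chart_dom_open.
    by rewrite -[X in measurable X]setTI; exact: measurable_tproj.
  apply/seteqP; split=> [_ [x Bx <-]|_ [[x cx <-] /= Bx]].
    by split; [exists x => //; exact: Bc|rewrite /=; have [_ _ ->] := cz _ (Bc _ Bx)].
  by exists x => //; have [_ _ <-] := cz _ cx.
- by move=> _ [x /Bc/cz[_ Lx _] <-].
- move=> _ _ [x /Bc/cz[zx _ _] <-] [y /Bc/cz[zy _ _] <-].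
  exact: ball_lattice_inj zx zy.
Qed.

End Area.

(** * The powers of the hyperbolic automorphism *)
Section Dilation.
Context {R : realType}.
Implicit Types (p q l z : R * R) (x y : ptorus R).
Notation mu := (@mu R).

Lemma eq_mx2 (A B : 'M[R]_2) : A 0 0 = B 0 0 -> A 0 1 = B 0 1 ->
  A 1 0 = B 1 0 -> A 1 1 = B 1 1 -> A = B.
Proof.
move=> h00 h01 h10 h11; apply/matrixP => i j.
have P (k : 'I_2) : k = 0 \/ k = 1.
  by case: k => [[|[|//]] k2]; [left|right]; apply/val_inj.
by case: (P i) => ->; case: (P j) => ->.
Qed.

Definition squeeze (k : int) : 'M[R]_2 :=
  \matrix_(i, j) if i != j then 0 else if i == 0 then mu ^ k else mu ^ (- k).

Lemma mu_neq0 : mu != 0. Proof. by rewrite gt_eqF// mu_gt0. Qed.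

Lemma squeeze0 : squeeze 0 = 1.
Proof. by apply: eq_mx2; rewrite !mxE/= ?oppr0 ?expr0z. Qed.

Lemma squeezeM j k : squeeze j * squeeze k = squeeze (j + k).
Proof.
by apply: eq_mx2; rewrite !mxE !big_ord_recl big_ord0 !mxE/= ?mulr0 ?mul0r ?addr0 ?add0r// ?opprD expfzDr// mu_neq0.
Qed.

Lemma det_squeeze k : \det (squeeze k) = 1.
Proof. by rewrite det2 !mxE/= mulr0 subr0 -expfzDr ?mu_neq0// subrr expr0z. Qed.

Lemma squeeze_unit k : squeeze k \in unitmx.
Proof. by rewrite unitmxE det_squeeze unitr1. Qed.

Lemma squeezeX (k : int) : squeeze 1 ^ k = squeeze k.
Proof.
have H (n : nat) : squeeze 1 ^+ n = squeeze n.
  elim: n => [|n IH]; first by rewrite expr0 squeeze0.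
  by rewrite exprS IH squeezeM -intS.
case: k => n; first by rewrite -exprnP H.
rewrite NegzE -exprnN H; apply: (@mulrI _ (squeeze n.+1)); first exact: squeeze_unit.
by rewrite divrr ?squeezeM ?subrr ?squeeze0//; exact: squeeze_unit.
Qed.

Lemma squeeze_inj : injective squeeze.
Proof.
move=> j k /matrixP/(_ 0 0); rewrite !mxE/=; apply: ieexprIz.
  exact: mu_gt0.
by rewrite gt_eqF// mu_gt1.
Qed.

(** Arithmetic-geometric mean: m + 1/m - 2 = (m - 1)^2 / m. *)
Lemma tr_squeeze (k : int) : k != 0 -> 2 < `|\tr (squeeze k)|.
Proof.
move=> k0; rewrite /mxtrace !big_ord_recl big_ord0 !mxE/= addr0 -invr_expz.
have m0 := mu_expz_gt0 (R := R) k.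
have m1 : mu ^ k != 1.
  by apply: contra_neq k0 => m1; apply: squeeze_inj; apply: eq_mx2; rewrite !mxE/= -?invr_expz ?m1 ?expr0z ?invr1.
rewrite gtr0_norm ?addr_gt0 ?invr_gt0//.
rewrite -subr_gt0 (_ : _ - 2 = (mu ^ k - 1) ^+ 2 / mu ^ k); last first.
  by field; rewrite gt_eqF.
by rewrite divr_gt0// exprn_even_gt0//= subr_eq0.
Qed.

Lemma squeeze_action k p : linear_action (squeeze k) p = (mu ^ k * p.1, mu ^ (- k) * p.2).
Proof. by rewrite /linear_action !mxE/= !mul0r addr0 add0r. Qed.

Lemma squeeze_actionK k p : linear_action (squeeze (- k)) (linear_action (squeeze k) p) = p.
Proof.
rewrite !squeeze_action opprK /= !mulrA -!expfzDr ?mu_neq0// addNr subrr !expr0z !mul1r.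
by case: p.
Qed.

Lemma squeeze_lattice k l : lattice l -> lattice (linear_action (squeeze k) l).
Proof. by rewrite squeeze_action => Ll; exact: (latticeM (lattice_unit k) Ll). Qed.

Lemma squeeze_latticeC k p : ~ lattice p -> ~ lattice (linear_action (squeeze k) p).
Proof. by move=> Lp /(squeeze_lattice (- k)); rewrite squeeze_actionK. Qed.

Lemma squeeze_homoclinic k p : homoclinic p -> homoclinic (linear_action (squeeze k) p).
Proof.
move=> [n Ln]; exists (k + n); have := squeeze_lattice k Ln.
by rewrite linear_actionB [linear_action _ (_, 0)]squeeze_action /= mulr0 expfzDr ?mu_neq0.
Qed.

Definition squeeze_map k x : ptorus R := tproj (linear_action (squeeze k) (val x)).

Lemma squeeze_map_tproj k p : ~ lattice p -> squeeze_map k (tproj p) = tproj (linear_action (squeeze k) p).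
Proof.
move=> Lp; apply/tprojP; [|exact: squeeze_latticeC|].
  by apply: squeeze_latticeC; exact: lattice_val.
by rewrite -linear_actionB; apply: squeeze_lattice; exact: lattice_val_tproj.
Qed.

Lemma squeeze_mapK k : cancel (squeeze_map k) (squeeze_map (- k)).
Proof.
move=> x; rewrite {2}/squeeze_map squeeze_map_tproj ?squeeze_actionK ?tprojK//.
by apply: squeeze_latticeC; exact: lattice_val.
Qed.

Lemma continuous_ptorus (T : topologicalType) (f : ptorus R -> T) :
  (forall p, ~ lattice p -> f (tproj q) @[q --> p] --> f (tproj p)) -> continuous f.
Proof.
move=> cf x; have [p Lp <-] := tproj_surj x => N /(cf p Lp)/nbhs_ballP[e /= e0 pN].
apply: filterS (nbhs_tproj_ball e0 Lp) => _ [q [pq _] <-]; exact: pN.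
Qed.

Lemma squeeze_map_continuous k : continuous (squeeze_map k).
Proof.
apply: continuous_ptorus => p Lp; rewrite squeeze_map_tproj//.
have : tproj (linear_action (squeeze k) q) @[q --> p] --> tproj (linear_action (squeeze k) p).
  exact: (cvg_comp _ _ (@cvg_linear_action R (squeeze k) p) (cvg_tproj (squeeze_latticeC (k := k) Lp))).
move=> h N /h; apply: filterS2 (open_nbhs_nbhs (conj open_latticeC Lp)) => q Lq.
by rewrite /= squeeze_map_tproj.
Qed.

Lemma squeeze_map_homeo k : homeomorphism (squeeze_map k).
Proof.
split; first exact: squeeze_map_continuous.
exists (squeeze_map (- k)); split; [exact: squeeze_map_continuous|exact: squeeze_mapK|].
by rewrite -{2}[k]opprK; exact: squeeze_mapK.
Qed.

Lemma squeeze_map_marked k x : marked x -> marked (squeeze_map k x).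
Proof.
move=> [p Hp <-]; rewrite squeeze_map_tproj; last exact: homoclinic_not_lattice.
by exists (linear_action (squeeze k) p) => //; exact: squeeze_homoclinic.
Qed.

Lemma chart_cvg (c : chart R (ptorus R)) x : chart_dom c x -> c y @[y --> x] --> c x.
Proof.
move=> cx; have := @chart_continuous _ _ c.
rewrite continuous_open_subspace; last exact: chart_dom_open.
by apply; rewrite inE.
Qed.

Lemma lattice_ball0 l : lattice l -> ball (0 : R * R) 1 l -> l = 0.
Proof.
move=> Ll [/=]; rewrite /ball/= !sub0r !normrN => l1 l2.
apply: lattice_small => //; rewrite normrM.
by have := normr_ge0 l.1; have := normr_ge0 l.2; nra.
Qed.

(** In two charts the map differs from the linear map by a lattice vector depending
    continuously on the point, hence locally constant. *)
Lemma squeeze_map_affine k x : affine_at (S := marked_torus) (squeeze_map k) (squeeze k) x.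
Proof.
move=> c d [_ [z cz]] [_ [w dw]] cx dx.
pose h y := d (squeeze_map k y) - linear_action (squeeze k) (c y).
have Lh y : chart_dom c y -> chart_dom d (squeeze_map k y) -> lattice (h y).
  move=> cy dy; have [_ Lc pc] := cz _ cy; have [_ Ld pd] := dw _ dy.
  apply/tprojP => //; first exact: squeeze_latticeC.
  by rewrite pd -squeeze_map_tproj// pc.
have c1 : d (squeeze_map k y) @[y --> x] --> d (squeeze_map k x).
  exact: (cvg_comp _ _ (@squeeze_map_continuous k x) (chart_cvg dx)).
have c2 : linear_action (squeeze k) (c y) @[y --> x] --> linear_action (squeeze k) (c x).
  exact: (cvg_comp _ _ (chart_cvg cx) (@cvg_linear_action R _ _)).
have ch : h y @[y --> x] --> h x by exact: (@cvgB _ _ _ _ (nbhs_filter x) _ _ _ _ c1 c2).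
have nh : \forall y \near x, `|h x - h y| < 1.
  exact: (cvgr_dist_lt _ _ ch 1 ltr01).
exists (h x).
have nc : \forall y \near x, chart_dom c y.
  by apply: open_nbhs_nbhs; split => //; exact: chart_dom_open.
have nd : \forall y \near x, chart_dom d (squeeze_map k y).
  apply: squeeze_map_continuous; apply: open_nbhs_nbhs; split => //; exact: chart_dom_open.
near=> y.
have hxy : h x - h y = 0.
  apply: lattice_ball0.
    by apply: latticeB; apply: Lh => //; near: y.
  by rewrite -ball_normE/= sub0r normrN; near: y; exact: nh.
by rewrite (subr0_eq hxy) /h addrC subrK.
Unshelve. all: by end_near. Qed.

Lemma squeeze_veech k : veech_group marked_torus (squeeze k).
Proof.
exists (squeeze_map k); last by move=> x _; exact: squeeze_map_affine.
split; first exact: squeeze_map_homeo.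
  apply/seteqP; split=> [_ [x mx <-]|x mx]; first exact: squeeze_map_marked.
  exists (squeeze_map (- k) x); first exact: squeeze_map_marked.
  by rewrite -{1}[k]opprK squeeze_mapK.
move=> x _; exists (squeeze k); split; [by rewrite det_squeeze|exact: squeeze_map_affine].
Qed.

End Dilation.

(** * Affine homeomorphisms lift to affine maps of the plane *)
Section Veech.
Context {R : realType}.
Implicit Types (p q l z : R * R) (x y : ptorus R).

Lemma subrBB (V : zmodType) (u v w : V) : (u - w) - (u - v) = v - w.
Proof. by rewrite opprB addrC addrA subrK. Qed.

Lemma nbhs_countableC (C : set (R * R)) p N : countable C -> nbhs p N ->
  exists2 q, N q & ~ C q.
Proof.
move=> Cc /nbhs_ballP[e /= e0 pN]; apply: contrapT => none.
have NC q : N q -> C q by move=> Nq; apply: contrapT => Cq; apply: none; exists q.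
have : lebesgue_measure ([set` `]p.1, (p.1 + e)[] : set R) = 0%E.
  apply: countable_lebesgue_measure0; apply: (@sub_countable _ _ _ (fst @` C)).
    apply: subset_card_le => t; rewrite /= in_itv/= => /andP[pt te].
    exists (t, p.2) => //; apply/NC/pN; split; rewrite /ball/= ?subrr ?normr0//.
    by rewrite ltr_distl; apply/andP; split; lra.
  exact: sub_countable (card_image_le _ _) Cc.
rewrite lebesgue_measure_itv/= lte_fin ltrDl e0 -EFinB addrAC subrr add0r.
by move=> [] /eqP; rewrite gt_eqF.
Qed.

Lemma exists_regular : exists2 p : R * R, ~ lattice p & ~ homoclinic p.
Proof.
have [p _ /not_orP[]] := nbhs_countableC (@countable_lattice_homoclinic R)
  (@filterT _ _ (nbhs_filter (0 : R * R))).
by exists p.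
Qed.

Lemma cvg_comp_tproj (f : ptorus R -> ptorus R) p : continuous f -> ~ lattice p ->
  f (tproj q) @[q --> p] --> f (tproj p).
Proof. move=> cf Lp; exact: (cvg_comp _ _ (cvg_tproj Lp) (cf _)). Qed.

Lemma local_section_regular p : ~ lattice p -> ~ homoclinic p ->
  exists c : chart R (ptorus R), [/\ flat_atlas c, chart_dom c (tproj p) &
    \forall q \near p, chart_dom c (tproj q) /\ c (tproj q) = q].
Proof.
move=> Lp Hp; have [|c [c1 c2 c3 c4]] := local_section_at open_homoclinicC _ (conj Lp Hp).
  by move=> q [].
exists c; split => //; split => // _ /c2[q [Lq Hq] <-].
by move=> /(markedP Lq).
Qed.

Section AffineLift.
Variables (f : ptorus R -> ptorus R) (B : 'M[R]_2).
Hypotheses (f_cont : continuous f) (f_regular : forall x, ~ marked x -> ~ marked (f x))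
  (f_affine : linear_part (S := marked_torus) f B).

Lemma affine_lift_local p : ~ lattice p -> ~ homoclinic p ->
  exists b, \forall q \near p, lattice (val (f (tproj q)) - linear_action B q - b).
Proof.
move=> Lp Hp.
have mp : ~ marked (tproj p) by move=> /(markedP Lp).
have mfp : ~ homoclinic (val (f (tproj p))) by move=> /marked_val; exact: f_regular.
have [c [ac cp cq]] := local_section_regular Lp Hp.
have [d [ad dp _]] := local_section_regular (@lattice_val R (f (tproj p))) mfp.
rewrite tprojK in dp.
have [b cdb] := f_affine mp ac ad cp dp; exists b.
have ncd : \forall q \near p, d (f (tproj q)) = linear_action B (c (tproj q)) + b.
  exact: (nbhs_tproj Lp cdb).
have nd : \forall q \near p, chart_dom d (f (tproj q)).
  apply: (cvg_comp_tproj f_cont Lp); apply: open_nbhs_nbhs; split => //.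
  exact: chart_dom_open.
near=> q.
have [_ cqq] : chart_dom c (tproj q) /\ c (tproj q) = q by near: q.
have dq : chart_dom d (f (tproj q)) by near: q.
have cdq : d (f (tproj q)) = linear_action B (c (tproj q)) + b by near: q.
rewrite cqq in cdq; rewrite -addrA -opprD -cdq.
have [_ [w dw]] := ad; have [_ Ldq pdq] := dw _ dq.
by apply/tprojP => //; [exact: lattice_val|rewrite tprojK].
Unshelve. all: by end_near. Qed.

(** Let g p be the difference between f (tproj p) and B p. Its class modulo the
    lattice is locally constant on the plane minus the lattice and the orbit,
    which is connected. *)
Lemma affine_lift_regular : exists b, forall p, ~ lattice p -> ~ homoclinic p ->
  lattice (val (f (tproj p)) - linear_action B p - b).
Proof.
pose Y : set (R * R) := ~` lattice `&` ~` homoclinic.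
have YE : Y = ~` (lattice `|` homoclinic) by rewrite setCU.
have cY : connected Y.
  by rewrite YE; apply: connected_countableC; exact: countable_lattice_homoclinic.
have [p0 Lp0 Hp0] := exists_regular.
pose g p := val (f (tproj p)) - linear_action B p.
pose b := g p0; exists b.
have loc p : Y p -> \forall q \near p, lattice (g q - g p).
  move=> [Lp Hp]; have [b' nb'] := affine_lift_local Lp Hp.
  have gp := nbhs_singleton nb'.
  apply: filterS nb' => q gq; have := latticeB gq gp.
  by rewrite -/(g q) -/(g p) opprB addrA subrK.
pose E : set (R * R) := Y `&` [set p | lattice (g p - b)].
suff EY : E = Y by move=> p Lp Hp; have : Y p by []; rewrite -EY => -[].
have oY : open Y by exact: open_homoclinicC.
apply: cY.
- by exists p0; split => //=; rewrite subrr; exact: lattice0.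
- exists E; last by rewrite setIA setIid.
  rewrite openE => p [Yp Ep]; apply: filterI; first exact: open_nbhs_nbhs.
  apply: filterS (loc p Yp) => q gq; have := latticeD gq Ep.
  by rewrite /= addrA subrK.
- exists (~` (Y `&` [set p | ~ lattice (g p - b)])).
    apply: open_closedC; rewrite openE => p [Yp Ep].
    apply: filterI; first exact: open_nbhs_nbhs.
    apply: filterS (loc p Yp) => q gq Eq; apply: Ep; have := latticeB Eq gq.
    by rewrite (subrBB (g q) (g p) b).
  apply/seteqP; split=> p [Yp Ep]; split => //; first by move=> [_]; apply.
  by apply: contrapT => nE; apply: Ep.
Qed.

(** The relation modulo the closed lattice passes to the limit at the marked
    points. The reduced lift [val] is not continuous, so the limit is taken
    through a nearby lift z of f (tproj q). *)
Lemma affine_lift : exists b, forall p, ~ lattice p ->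
  lattice (val (f (tproj p)) - linear_action B p - b).
Proof.
have [b Hb] := affine_lift_regular; exists b => p Lp.
apply: contrapT => /lattice_isolated[e e0 He].
have e20 : 0 < e / 2 by rewrite divr_gt0.
have n1 : \forall q \near p, (tproj @` (ball (val (f (tproj p))) (e / 2) `&` ~` lattice)) (f (tproj q)).
  apply: (cvg_comp_tproj f_cont Lp).
  by rewrite -{1}[f (tproj p)]tprojK; apply: nbhs_tproj_ball => //; exact: lattice_val.
have n2 : \forall q \near p, `|linear_action B p - linear_action B q| < e / 2.
  exact: (cvgr_dist_lt _ _ (@cvg_linear_action R B p) _ e20).
have n3 : \forall q \near p, ~ lattice q by exact: (open_nbhs_nbhs (conj open_latticeC Lp)).
have [q [[[z [hz Lz] zq] n2q] n3q] Hq] := nbhs_countableC (@countable_homoclinic R) (filterI (filterI n1 n2) n3).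
apply: (He (z - linear_action B q - b)).
  have Lzq : lattice (z - val (f (tproj q))).
    by apply/tprojP => //; [exact: lattice_val|rewrite tprojK].
  have := latticeD Lzq (Hb q n3q Hq).
  by move: (val _) (linear_action _ _) => v u; rewrite -[v - u - b]addrA subrKA addrA.
move: hz; rewrite -!ball_normE/= => hz.
rewrite [e]splitr; apply: le_lt_trans (ltrD hz n2q).
apply: le_trans (ler_normB _ _).
move: (val _) (linear_action B p) (linear_action B q) => v u w.
rewrite (_ : _ - (z - w - b) = (v - z) - (u - w))//.
by rewrite (opprB (z - w)) addrA subrK !opprB [w - z]addrC addrACA [- u + w]addrC.
Qed.

End AffineLift.

End Veech.

(** * The Veech group *)
Section VeechGroup.
Context {R : realType}.
Implicit Types (p q l z : R * R) (x y : ptorus R).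

(** If b is not in the lattice, its class is a point of the surface, and the
    classes of B q + b converge to it as q tends to 0. They are the images under
    f of the classes of q, which would then converge to the preimage of the
    class of b, although they tend to the puncture. *)
Lemma affine_lift_origin (f g : ptorus R -> ptorus R) (B : 'M[R]_2) b :
  continuous g -> cancel f g ->
  (forall p, ~ lattice p -> lattice (val (f (tproj p)) - linear_action B p - b)) ->
  lattice b.
Proof.
move=> g_cont fK Hb; apply: contrapT => Lb.
pose z := val (g (tproj b)); have Lz : ~ lattice z by exact: lattice_val.
have [e e0 He] := lattice_isolated Lz.
have e20 : 0 < e / 2 by rewrite divr_gt0.
have B0 : linear_action B 0 = 0 by rewrite /linear_action /= !mulr0 addr0.
have w0 : linear_action B q + b @[q --> (0 : R * R)] --> b.
  have bE : linear_action B 0 + b = b by rewrite B0 add0r.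
  rewrite -[X in _ --> X]bE.
  by apply: cvgD; [exact: cvg_linear_action|exact: cvg_cst].
have n1 : \forall q \near (0 : R * R),
    (tproj @` (ball z (e / 2) `&` ~` lattice)) (g (tproj (linear_action B q + b))).
  have N : nbhs (g (tproj b)) (tproj @` (ball z (e / 2) `&` ~` lattice)).
    by rewrite -[g (tproj b)]tprojK; exact: nbhs_tproj_ball.
  exact: (w0 _ (cvg_comp_tproj g_cont Lb N)).
have n2 : \forall q \near (0 : R * R), ball (0 : R * R) (e / 2) q by exact: nbhsx_ballx.
have n3 : \forall q \near (0 : R * R), ~ lattice (linear_action B q + b).
  exact: (w0 _ (open_nbhs_nbhs (conj open_latticeC Lb))).
have [q [[[z' [zz' Lz'] z'q] n2q] n3q] Lq] :=
  nbhs_countableC (@countable_lattice R) (filterI (filterI n1 n2) n3).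
have fq : f (tproj q) = tproj (linear_action B q + b).
  rewrite -[LHS]tprojK; apply/tprojP => //; first exact: lattice_val.
  by rewrite opprD addrA; exact: Hb.
apply: (He (z' - q)); first by apply/tprojP => //; rewrite z'q -fq fK.
move: zz' n2q; rewrite -!ball_normE/= sub0r normrN => zz' n2q.
rewrite opprB addrCA [q + _]addrC.
by rewrite [e]splitr; apply: le_lt_trans (ler_normD _ _) _; exact: ltrD.
Qed.

(** The matrix is recovered from the values at three points that are not
    collinear; this transfers positivity of the determinant from the pointwise
    matrices to the linear part. *)
Lemma affine_at_unique (f : ptorus R -> ptorus R) (A B : 'M[R]_2) x :
  ~ marked x -> ~ marked (f x) -> affine_at (S := marked_torus) f A x ->
  affine_at (S := marked_torus) f B x -> A = B.
Proof.
have [p Lp <-] := tproj_surj x => /(contra_not (markedP Lp).2) Hp.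
move=> /(contra_not (marked_val _).2) Hfp Af Bf.
have [c [ac cp cq]] := local_section_regular Lp Hp.
have [d [ad dp _]] := local_section_regular (@lattice_val R (f (tproj p))) Hfp.
rewrite tprojK in dp.
have [a Aa] := Af _ _ ac ad cp dp; have [b Bb] := Bf _ _ ac ad cp dp.
have nAB : \forall q \near p, linear_action A q + a = linear_action B q + b.
  have nA := nbhs_tproj Lp Aa; have nB := nbhs_tproj Lp Bb.
  apply: filterS3 nA nB cq => q /= hA hB [_ <-]; by rewrite -hA -hB.
have /nbhs_ballP[e /= e0 He] := nAB.
have e2 : 0 < e / 2 by rewrite divr_gt0.
have e2e : e / 2 < e by rewrite ltr_pdivrMr// ltr_pMr// ltr1n.
have [h1 h2] := He p (ballxx _ e0).
have [] : linear_action A (p.1 + e / 2, p.2) + a = linear_action B (p.1 + e / 2, p.2) + b.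
  apply: He; split; rewrite /ball/= ?subrr ?normr0//.
  by rewrite opprD addrA subrr sub0r normrN gtr0_norm.
have [] : linear_action A (p.1, p.2 + e / 2) + a = linear_action B (p.1, p.2 + e / 2) + b.
  apply: He; split; rewrite /ball/= ?subrr ?normr0//.
  by rewrite opprD addrA subrr sub0r normrN gtr0_norm.
move: h1 h2 => /= h1 h2 h3 h4 h5 h6.
have cancel_e (s t : R) : s * (e / 2) = t * (e / 2) -> s = t.
  by apply: mulIf; rewrite gt_eqF.
by apply: eq_mx2; apply: cancel_e; lra.
Qed.

Lemma veech_group_squeeze (B : 'M[R]_2) : veech_group marked_torus B -> exists k, B = squeeze k.
Proof.
move=> [f [[f_cont [g [g_cont fK gK]]] f_marked f_pos] f_affine].
have f_regular x : ~ marked x -> ~ marked (f x).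
  move=> mx mfx; have : [set f x | x in marked] (f x) by rewrite f_marked.
  by move=> [y my /(can_inj fK) yx]; apply: mx; rewrite -yx.
have [b Hb] := affine_lift f_cont f_regular f_affine.
have Lb := affine_lift_origin g_cont fK Hb.
have fB p : ~ lattice p -> lattice (val (f (tproj p)) - linear_action B p).
  by move=> Lp; have := latticeD (Hb p Lp) Lb; rewrite subrK.
have detB : 0 < \det B.
  have [q Lq Hq] := @exists_regular R.
  have mq : ~ marked (tproj q) by move=> /(markedP Lq).
  have [A [detA fA]] := f_pos _ mq.
  by rewrite -(affine_at_unique mq (f_regular _ mq) fA (f_affine _ mq)).
have h_marked p : homoclinic p -> homoclinic (val (f (tproj p))).
  move=> Hp; apply/marked_val.
  have : [set f x | x in marked] (f (tproj p)) by exists (tproj p) => //; exists p.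
  by rewrite f_marked.
have [||k [e1 e2 e3 e4]] := lattice_homoclinic_preserved detB.
- move=> l Ll; have [p Lp _] := tproj_surj (@base_point R).
  have Lpl := lattice_shift Ll Lp.
  have := latticeB (fB _ Lp) (fB _ Lpl).
  have -> : tproj (p + l) = tproj p.
    by apply/tprojP => //; rewrite addrAC subrr add0r.
  rewrite linear_actionD; move: (val _) (linear_action _ _) (linear_action _ _) => v u w.
  by rewrite opprB addrC addrA subrK addrAC subrr add0r.
- move=> p Hp; have Lp := homoclinic_not_lattice Hp.
  have := homoclinicD (latticeN (fB _ Lp)) (h_marked _ Hp).
  by rewrite opprB addrC subrK.
- by exists k; apply: eq_mx2; rewrite !mxE/=.
Qed.

End VeechGroup.

Theorem theorem1p1 (R : realType) :
  exists S : translation_surface R,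
    [/\ finite_area S,
        veech_group S `<=` @SL2 R,
        infinite_cyclic (veech_group S) &
        forall A : 'M[R]_2, veech_group S A -> A <> 1 -> hyperbolic A].
Proof.
have veechE : veech_group (@marked_torus R) = range (@squeeze R).
  by apply/seteqP; split=> [B /veech_group_squeeze[k ->]|_ [k _ <-]];
    [exists k|exact: squeeze_veech].
exists marked_torus; rewrite veechE; split.
- exact: marked_torus_finite_area.
- by move=> _ [k _ <-]; exact: det_squeeze.
- split; last first.
    exists (squeeze 1); first exact: squeeze_unit.
    by apply/seteqP; split=> [_ [k _ <-]|_ [k _ <-]]; exists k => //; rewrite squeezeX.
  apply: (@sub_infinite_set _ ((fun n : nat => @squeeze R n) @` setT)).
    by move=> _ [n _ <-]; exists n.
  rewrite (eq_finite_set (inj_card_eq _)); first exact: infinite_nat.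
  by move=> m n _ _ /squeeze_inj[].
- move=> _ [k _ <-] k1; split; first exact: det_squeeze.
  by apply: tr_squeeze; apply/eqP => k0; apply: k1; rewrite k0 squeeze0.
Qed.
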